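(* Let $k$ be a field, $P$ a polynomial ring in three variables over $k$, each variable of degree $1$. Let $f$ be a non-zero homogeneous element of $P$, $R=P/(f)$, and $a$ the $a$-invariant of $R$. Let $I$ be a homogeneous grade three Gorenstein ideal in $P$, $b$ the back twist in the $P$-resolution of $P/I$, and $J=IR$. Let $$\mathbb F_\bullet:\quad \cdots \xrightarrow{d_4}\mathbb F_3\xrightarrow{d_3}\mathbb F_2\xrightarrow{d_2}\mathbb F_1\xrightarrow{d_1}R\to R/J\to 0$$ be the graded minimal $R$-resolution of $R/J$, and let $\{\sigma_i\mid 1\le i\le s\}$ be the socle degrees of $R/J$. Assume that (a) $I$ and $J$ have the same number of minimal generators, (b) $\operatorname{rank}\mathbb F_2=\dim_k\operatorname{soc}(R/J)$, and (c) $\sigma_i+\sigma_j\neq b+2a$ for any pair $(i,j)$. Then, as graded $R$-modules, (A) $\mathbb F_2=\bigoplus_{i=1}^s R(-(b+a-\sigma_i))$, (B) $\mathbb F_3=\bigoplus_{i=1}^s R(-(\sigma_i+3))$, and (C) $\mathbb F_{i+2}=\mathbb F_i(-|f|)$ for all $i\ge 2$.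
   Context: The field $k$ has arbitrary characteristic. $|f|$ denotes the degree of $f$. The $a$-invariant of the hypersurface ring $R=P/(f)$ is $a=|f|-3$ (so the graded canonical module of $R$ is $R(a)$). For a homogeneous Gorenstein ideal $I$ of $P$ (i.e. $P/I$ is a Gorenstein ring), the last non-zero module in the minimal homogeneous free $P$-resolution of $P/I$ has rank one and equals $P(-b)$ for some integer $b$; this $b$ is called the back twist. The socle of $R/J$ is $\operatorname{soc}(R/J)=(J:\mathfrak m)/J$, where $\mathfrak m$ is the irrelevant (homogeneous maximal) ideal of $R$; it is a finite-dimensional graded $k$-vector space, and the socle degrees of $R/J$ are the degrees (with multiplicity) of the elements of any homogeneous basis of it, so $s=\dim_k\operatorname{soc}(R/J)$. $M(n)$ denotes the graded module with $M(n)_j=M_{n+j}$. In (c), $i=j$ is allowed. *)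

(* Defs.v *)
From HB Require Import structures.
From mathcomp Require Import all_boot all_order all_algebra.
From mathcomp Require Export mpoly.

Set Implicit Arguments.
Unset Strict Implicit.
Unset Printing Implicit Defensive.

Import Order.TTheory GRing.Theory Num.Theory.
Local Open Scope ring_scope.

(* Ideals and other subsets of rings are Prop-valued predicates.  Quotient
   rings are given by their projection (see is_quotient below): the quotients
   of ring_quotient.v are restricted to proper ideals, whereas P/(f) is the zero
   ring when f is a non-zero constant.  For the same reason rings are
   comPzRingType's. *)

Section Ideals.
Variable A : comPzRingType.
Implicit Types (I M X : A -> Prop).

Definition is_ideal I : Prop :=
  [/\ I 0, forall x y, I x -> I y -> I (x + y) & forall c x, I x -> I (c * x)].

Definition ideal_gen X (x : A) : Prop :=
  exists (n : nat) (c g : 'I_n -> A),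
    (forall i, X (g i)) /\ x = \sum_(i < n) c i * g i.

Definition generates (s : seq A) I : Prop :=
  forall x, I x <-> ideal_gen (fun y => y \in s) x.

Definition min_number_of_generators I (n : nat) : Prop :=
  (exists2 s : seq A, size s = n & generates s I) /\
  (forall s : seq A, generates s I -> (n <= size s)%N).

Definition noetherian : Prop :=
  forall I, is_ideal I -> exists s : seq A, generates s I.

Definition maximal_ideal M : Prop :=
  [/\ is_ideal M, ~ M 1 &
      forall I, is_ideal I -> (forall x, M x -> I x) -> ~ I 1 ->
        forall x, I x -> M x].

Definition regular_sequence (s : seq A) : Prop :=
  ~ ideal_gen (fun y => y \in s) 1 /\
  forall i, (i < size s)%N -> forall x,
    ideal_gen (fun y => y \in take i s) (s`_i * x) ->
    ideal_gen (fun y => y \in take i s) x.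

(* The grade of the unit ideal is infinite by convention. *)
Definition has_grade I (g : nat) : Prop :=
  [/\ ~ I 1,
      exists s : seq A,
        [/\ regular_sequence s, forall x, x \in s -> I x & size s = g] &
      forall s : seq A, regular_sequence s -> (forall x, x \in s -> I x) ->
        (size s <= g)%N].

End Ideals.

Definition is_quotient (A B : comPzRingType) (q : {rmorphism A -> B})
    (I : A -> Prop) : Prop :=
  (forall y, exists x, q x = y) /\ (forall x, q x = 0 <-> I x).

Definition extended_ideal (A B : comPzRingType) (q : {rmorphism A -> B})
    (I : A -> Prop) : B -> Prop :=
  ideal_gen (fun y => exists2 x, I x & q x = y).

Definition is_localization_at (A B : comPzRingType) (phi : {rmorphism A -> B})
    (M : A -> Prop) : Prop :=
  [/\ forall s, ~ M s -> exists y, phi s * y = 1,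
      forall y, exists x s, ~ M s /\ phi s * y = phi x &
      forall x, phi x = 0 -> exists s, ~ M s /\ s * x = 0].

Definition injective_module (B : comPzRingType) (E : lmodType B) : Prop :=
  forall (M N : lmodType B) (i : {linear M -> N}) (g : {linear M -> E}),
    injective i -> exists h : {linear N -> E}, forall x, h (i x) = g x.

Fixpoint inj_dim_le (B : comPzRingType) (n : nat) (M : lmodType B) : Prop :=
  if n is n'.+1 then
    exists (E C : lmodType B) (f : {linear M -> E}) (g : {linear E -> C}),
      [/\ injective_module E, injective f,
          forall x, g x = 0 <-> exists y, f y = x,
          forall z, exists x, g x = z &
          inj_dim_le n' C]
  else injective_module M.

Definition gorenstein (A : comPzRingType) : Prop :=
  noetherian A /\
  forall M : A -> Prop, maximal_ideal M ->
  forall (B : comPzRingType) (phi : {rmorphism A -> B}),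
    is_localization_at phi M -> exists n, inj_dim_le n (B^o : lmodType B).

Definition homogeneous_ideal (k : fieldType) (n : nat)
    (I : {mpoly k[n]} -> Prop) : Prop :=
  is_ideal I /\ forall d p, I p -> I (pihomog mdeg d p).

(* The a-invariant of k[x, y, z]/(f), for f homogeneous of degree d. *)
Definition a_invariant (d : nat) : int := d%:Z - 3.

(* In the sequel A is a standard graded k-algebra, the quotient of
   k[x_1, ..., x_n] by a homogeneous ideal, with projection pi; pi is the
   identity when A is the polynomial ring itself. *)
Section Graded.
Variables (k : fieldType) (n : nat) (A : comPzRingType).
Variable pi : {mpoly k[n]} -> A.

Definition hdeg (z : int) (x : A) : Prop :=
  match z with
  | Posz d => exists2 p, p \is d.-homog & pi p = x
  | Negz _ => x = 0
  end.

Definition irrelevant_ideal : A -> Prop :=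
  ideal_gen (fun x => exists i : 'I_n, x = pi 'X_i).

(* A graded module is a module M with, for each z, the subset M_z. *)
Record gmodule := GModule {
  gm_carrier :> lmodType A;
  gm_deg : int -> gm_carrier -> Prop }.

Definition gm_iso (M N : gmodule) : Prop :=
  exists phi : {linear M -> N},
    bijective phi /\ forall z x, gm_deg z x <-> gm_deg z (phi x).

(* M(d), with M(d)_z = M_(d + z) *)
Definition gm_twist (M : gmodule) (d : int) : gmodule :=
  @GModule M (fun z x => @gm_deg M (d + z) x).

(* The direct sum of the A(- t i), for i < m. *)
Definition gm_free (m : nat) (t : 'I_m -> int) : gmodule :=
  @GModule 'rV[A]_m (fun z x => forall i, hdeg (- t i + z) (x 0 i)).

(* A sequence of free modules F_i, the direct sum of the A(- gc_shift i u) for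
   u < gc_rank i, and of maps F_i.+1 -> F_i. Matrices act on row vectors. *)
Record gcomplex := GComplex {
  gc_rank : nat -> nat;
  gc_shift : forall i, 'I_(gc_rank i) -> int;
  gc_diff : forall i, 'M[A]_(gc_rank i.+1, gc_rank i) }.
Arguments gc_shift : clear implicits.

Definition gc_mod (F : gcomplex) (i : nat) : gmodule := gm_free (gc_shift F i).

(* F is a minimal graded free resolution of A/J, with F_0 = A.
   As F_0 has rank one, const_mx r is the element r of F_0. *)
Definition minimal_resolution (F : gcomplex) (J : A -> Prop) : Prop :=
  [/\ gc_rank F 0 = 1%N /\ forall u, gc_shift F 0 u = 0,
      forall i z (x : 'rV[A]_(gc_rank F i.+1)),
        @gm_deg (gc_mod F i.+1) z x ->
        @gm_deg (gc_mod F i) z (x *m gc_diff F i),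
      forall r, J r <->
        exists x : 'rV[A]_(gc_rank F 1), x *m gc_diff F 0 = const_mx r,
      forall i (x : 'rV[A]_(gc_rank F i.+1)),
        x *m gc_diff F i = 0 <-> exists y, y *m gc_diff F i.+1 = x &
      forall i u v, irrelevant_ideal (gc_diff F i u v)].

(* The last non-zero module of F is A(- b). *)
Definition back_twist (F : gcomplex) (b : int) : Prop :=
  exists l, [/\ gc_rank F l = 1%N, forall u, gc_shift F l u = b &
                forall i, (l < i)%N -> gc_rank F i = 0%N].

(* J : m; the socle of A/J is its image in A/J *)
Definition socle_lift (J : A -> Prop) (x : A) : Prop :=
  forall y, irrelevant_ideal y -> J (x * y).

(* sigma lists the degrees of the elements of a homogeneous k-basis of the
   socle of A/J; in particular the dimension of the socle is s. *)
Definition socle_degrees (J : A -> Prop) (s : nat) (sigma : 'I_s -> int) :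
    Prop :=
  exists u : 'I_s -> A,
    [/\ forall i, hdeg (sigma i) (u i) /\ socle_lift J (u i),
        forall c : 'I_s -> k,
          J (\sum_i pi (c i)%:MP * u i) -> forall i, c i = 0 &
        forall x, socle_lift J x ->
          exists c : 'I_s -> k, J (x - \sum_i pi (c i)%:MP * u i)].

End Graded.

(* Main.v *)
Require Import Defs.
From HB Require Import structures.
From mathcomp Require Import all_boot all_order all_algebra all_fingroup.
From mathcomp Require Import ring zify.
From mathcomp Require Import mpoly.
From Stdlib Require Import Classical IndefiniteDescription.

(* Write h_1, ..., h_r for the elements with Phi g = f h, where g generates I and
   Phi is a lift to P of the second differential of F.  They generate (I : f)
   modulo I.  As the last module of G is P(-b) and I contains a regular sequence
   of length three, P/I is a finite-dimensional algebra with simple socle in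
   degree b - 3; so it is self-dual, and the double annihilator property of (I, f)
   makes the pairing (u, h) |-> u h of the socle of R/J with the h_j perfect;
   hypothesis (b) makes it square, and a non-zero term of its determinant matches
   the degrees of the h_j with those of the socle elements.  This is (A).
   The lifts to P of the relations between the rows of Phi modulo f form a third
   syzygy module of P/(I, f); it is free, it contains f P^r, and the resulting
   resolution of P/(I, f) of length three identifies its generators with the socle
   of R/J, in degrees shifted by 3.  So a minimal set of generators is one factor
   of a matrix factorization of f; by (A) and (c) the other factor has no
   entry of degree 0, and the resolution over R is the 2-periodic one given by the
   matrix factorization. *)

Set Implicit Arguments.
Unset Strict Implicit.
Unset Printing Implicit Defensive.

Import GRing.Theory.
Local Open Scope ring_scope.

(** * Homogeneous components at integer degrees *)

Section Components.
Variables (k : fieldType) (n : nat).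
Implicit Types (p q : {mpoly k[n]}) (z y : int).

(** Tor never occurs as an object. The comparison of Tor_3(-, k) with the socle is made by explicit
    staircases in the double complex of a resolution and the Koszul complex on the variables. They
    serve twice: for P/I with [G], where rank one of the last module makes the socle simple, and for
    P/(I, f), where they match generators of the third syzygy module with the socle of R/J. The two
    scalar matrices that match degrees with socle degrees are only shown to be injective; a bound on
    their sizes then makes them square. Hypothesis (a) enters where minimal generators of J are
    lifted to elements of I: it ensures that the lifts generate I, so that every relation f q in I
    is seen by Phi. Hypothesis (c) is about one degree: since |f| = a + 3, an entry of the second
    factor has degree b + 2a - sigma_i - sigma_j, so (c) excludes constants in it. Degrees are
    integers because shifts are; components of negative degree are 0. *)

Definition hcomp z p : {mpoly k[n]} := if z is Posz e then pihomog mdeg e p else 0.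

Arguments hcomp : simpl never.

Lemma hcomp_is_linear z : linear (hcomp z).
Proof. by case: z => e c p q; rewrite /hcomp ?scaler0 ?addr0 // linearP. Qed.
HB.instance Definition _ z :=
  GRing.isLinear.Build k {mpoly k[n]} {mpoly k[n]} *:%R (hcomp z) (hcomp_is_linear z).

Lemma hcomp_big (I : Type) (r : seq I) (Q : pred I) z (F : I -> {mpoly k[n]}) :
  hcomp z (\sum_(i <- r | Q i) F i) = \sum_(i <- r | Q i) hcomp z (F i).
Proof. exact: raddf_sum. Qed.

Lemma hcompD z p q : hcomp z (p + q) = hcomp z p + hcomp z q.
Proof. exact: raddfD. Qed.

Definition ishom z p := hcomp z p = p.

Lemma mcoeff_hcomp z p m : (hcomp z p)@_m = if (mdeg m)%:Z == z then p@_m else 0.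
Proof.
elim/mpolyind: p => [|c m' p _ _ IH]; first by rewrite raddf0 mcoeff0; case: ifP.
rewrite linearP /= mcoeffD mcoeffZ IH mcoeffD mcoeffZ.
have -> : (hcomp z 'X_[m'])@_m = if (mdeg m)%:Z == z then ('X_[k, m'])@_m else 0.
  case: z {IH} => [e|e]; rewrite /hcomp; last by rewrite mcoeff0.
  rewrite pihomogX (eqz_nat (mdeg m) e).
  case: ifP => [/eqP <-|/eqP ne]; rewrite ?mcoeff0 mcoeffX.
    by case: (m' =P m) => [->|_]; rewrite ?eqxx //; case: ifP.
  by case: (m' =P m) => [<-|_]; case: eqP.
by case: ifP => _; rewrite ?mulr0 ?addr0.
Qed.

Lemma ishomP z p : ishom z p <-> forall m, (mdeg m)%:Z != z -> p@_m = 0.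
Proof.
split=> [E m ne|H]; first by rewrite -E mcoeff_hcomp (negbTE ne).
by apply/mpolyP => m; rewrite mcoeff_hcomp; case: eqP => // /eqP /H ->.
Qed.

Lemma hcomp_hom z p : ishom z (hcomp z p).
Proof. by apply/ishomP => m ne; rewrite mcoeff_hcomp (negbTE ne). Qed.

Lemma hcomp_neq z y p : ishom y p -> z != y -> hcomp z p = 0.
Proof.
move=> /ishomP H ne; apply/mpolyP => m; rewrite mcoeff_hcomp mcoeff0.
by case: eqP => // E; apply: H; rewrite E.
Qed.

Lemma ishom0 z : ishom z 0.
Proof. exact: raddf0. Qed.

Lemma ishomD z p q : ishom z p -> ishom z q -> ishom z (p + q).
Proof. by rewrite /ishom raddfD /= => -> ->. Qed.

Lemma ishomN z p : ishom z p -> ishom z (- p).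
Proof. by rewrite /ishom raddfN /= => ->. Qed.

Lemma ishom_sum (I : Type) (r : seq I) (P : pred I) z (F : I -> {mpoly k[n]}) :
  (forall i, P i -> ishom z (F i)) -> ishom z (\sum_(i <- r | P i) F i).
Proof. by move=> H; elim/big_ind: _; [exact: ishom0 | exact: ishomD |]. Qed.

Lemma dhomog_ishom (e : nat) p : p \is e.-homog <-> ishom e p.
Proof. by rewrite homog_piE; split=> /eqP. Qed.

Lemma ishomC (c : k) : ishom 0 c%:MP.
Proof.
apply/ishomP => m; rewrite mcoeffC eqz_nat mdeg_eq0 => /negbTE ->.
by rewrite mulr0.
Qed.

Lemma ishomX i : ishom 1 ('X_i : {mpoly k[n]}).
Proof. by apply/(dhomog_ishom 1); rewrite dhomogX /= mdeg1. Qed.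

Lemma ishom_const z p : ishom z p -> z = 0 -> p = (p@_0)%:MP.
Proof.
move=> /ishomP H z0; apply/mpolyP => m; rewrite mcoeffC.
case: (m =P 0%MM) => [->|/eqP ne]; rewrite ?mulr1 // mulr0 H // z0.
by rewrite eqz_nat mdeg_eq0.
Qed.

Lemma ishom_coeff0 z p : ishom z p -> p@_0 != 0 -> z = 0.
Proof. by move=> /ishomP H; apply: contra_neq_eq => ne; apply: H; rewrite mdeg0 eq_sym. Qed.

Lemma coeff0_hcomp p : (hcomp 0 p)@_0 = p@_0.
Proof. by rewrite mcoeff_hcomp mdeg0. Qed.

(** Integer degrees spare the case z < y, where both sides are 0. By linearity p may be taken to be
    a monomial. *)
Lemma hcompMl y z (a p : {mpoly k[n]}) : ishom y a ->
  hcomp z (a * p) = a * hcomp (z - y) p.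
Proof.
move=> ha; elim/mpolyind: p => [|c m p _ _ IH]; first by rewrite mulr0 !raddf0 mulr0.
rewrite mulrDr -scalerAr !linearP /= IH mulrDr -scalerAr; congr (_ *: _ + _).
apply/mpolyP => m'; rewrite mcoeff_hcomp.
have -> : hcomp (z - y) 'X_[m] = if (mdeg m)%:Z == z - y then 'X_[k, m] else 0.
  apply/mpolyP => m1; rewrite mcoeff_hcomp mcoeffX.
  case: (m =P m1) => [->|ne]; first by case: ifP; rewrite ?mcoeff0 // mcoeffX eqxx.
  by case: ifP; case: ifP; rewrite ?mcoeff0 // mcoeffX; case: (m =P m1).
case: (boolP (m <= m')%MM) => [le|nle].
  rewrite -(submK le) addmC mcoeffMX mdegD.
  case: (ifP (_ == z - y)) => [/eqP E|/eqP ne].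
    rewrite mcoeffMX; case: eqP => // ne.
    by move/ishomP: ha => ->//; apply/eqP => E2; apply: ne; rewrite PoszD E2 E; ring.
  rewrite mulr0 mcoeff0; case: eqP => // E.
  move/ishomP: ha => -> //; apply/eqP => E2; apply: ne.
  by rewrite -E PoszD E2; ring.
have z0 : (a * 'X_[m])@_m' = 0.
  apply: memN_msupp_eq0; rewrite (perm_mem (msuppMX _ _)).
  by apply/mapP => [[m1 _ E]]; move: nle; rewrite E lem_addr.
by rewrite z0 if_same; case: ifP; rewrite ?z0 ?mulr0 ?mcoeff0.
Qed.

Lemma ishomM y z (a p : {mpoly k[n]}) : ishom y a -> ishom z p -> ishom (y + z) (a * p).
Proof. by move=> ha hp; rewrite /ishom (hcompMl _ _ ha) addrC addKr hp. Qed.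

Lemma hcompXl z i p : hcomp z ('X_i * p) = 'X_i * hcomp (z - 1) p.
Proof. exact: hcompMl (ishomX i). Qed.

Lemma hcomp_sum p : p = \sum_(e < msize p) hcomp e p.
Proof. by rewrite {1}(pihomog_partitionE (mf := mdeg) (leqnn (msize p))). Qed.

Lemma hcomp_eq0 p : (forall e : nat, hcomp e p = 0) -> p = 0.
Proof. by move=> H; rewrite (hcomp_sum p) big1. Qed.

End Components.

(** * The Koszul complex on the variables *)

Section Kill.
Variables (k : fieldType) (n : nat) (T : pred 'I_n).
Implicit Types p : {mpoly k[n]}.

(** The projection modulo the variables of [T], realised inside P as a retraction onto the
    polynomials in the other variables. *)
Definition kill p : {mpoly k[n]} :=
  p \mPo [tuple if T i then 0 else 'X_i | i < n].

Lemma killX i : kill 'X_i = if T i then 0 else 'X_i.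
Proof. by rewrite /kill comp_mpolyXU -tnth_nth tnth_mktuple. Qed.

Lemma kill_sub p : exists v : 'I_n -> {mpoly k[n]},
  p = kill p + \sum_(i | T i) 'X_i * v i.
Proof.
pose D p := exists v : 'I_n -> {mpoly k[n]}, p = kill p + \sum_(i | T i) 'X_i * v i.
have D0 : D 0 by exists (fun=> 0); rewrite big1 ?addr0 /kill ?raddf0 // => i; rewrite mulr0.
have DD : forall p q, D p -> D q -> D (p + q).
  move=> q r [v E] [w E']; exists (fun i => v i + w i).
  rewrite {1}E {1}E' /kill raddfD /= addrACA; congr (_ + _).
  by rewrite -big_split; apply: eq_bigr => i _ /=; rewrite mulrDr.
have DM : forall p q, D p -> D q -> D (p * q).
  move=> q r [v E] [w E']; exists (fun i => v i * r + kill q * w i).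
  rewrite {1}E mulrDl {1}E' mulrDr /kill rmorphM /= -addrA; congr (_ + _).
  rewrite addrC mulr_suml mulr_sumr -big_split; apply: eq_bigr => i _ /=.
  by ring.
have DC : forall c, D c%:MP.
  by move=> c; exists (fun=> 0); rewrite big1 ?addr0 /kill ?comp_mpolyC // => i; rewrite mulr0.
have DX : forall i, D 'X_i.
  move=> i; exists (fun j => if j == i then 1 else 0); rewrite killX.
  case: ifP => Ti; last first.
    rewrite big1 ?addr0 // => j; case: eqP => [->|]; rewrite ?mulr0 //.
    by rewrite Ti.
  rewrite add0r (bigD1 i) //= eqxx mulr1 big1 ?addr0 // => j /andP [_ /negbTE ->].
  by rewrite mulr0.
change (D p); elim/mpolyind: p => [|c m p _ _ IH] //; apply: (DD) => //.
rewrite -mul_mpolyC; apply: (DM) => //; rewrite mpolyXE_id.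
apply: (big_ind D) => [||i _]; [by rewrite -mpolyC1 | exact: DM |].
by elim: (m i) => [|e IHe]; rewrite ?expr0 -?mpolyC1 // exprS; apply: (DM).
Qed.

Lemma kill_comb (v : 'I_n -> {mpoly k[n]}) : kill (\sum_(i | T i) 'X_i * v i) = 0.
Proof.
rewrite /kill raddf_sum big1 //= => i Ti; rewrite rmorphM /=.
by have := killX i; rewrite /kill Ti => ->; rewrite mul0r.
Qed.

(** Modulo the variables of [T] the ring is still a domain, in which the variable of index j is
    non-zero; applying [kill] thus gives [kill p = 0]. *)
Lemma kill_regular j p (v : 'I_n -> {mpoly k[n]}) : ~~ T j ->
  'X_j * p = \sum_(i | T i) 'X_i * v i ->
  exists w : 'I_n -> {mpoly k[n]}, p = \sum_(i | T i) 'X_i * w i.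
Proof.
move=> Tj E; have [w Ew] := kill_sub p; exists w; rewrite {1}Ew.
suff -> : kill p = 0 by rewrite add0r.
have := kill_comb v; rewrite -E /kill rmorphM /=.
have := killX j; rewrite /kill (negbTE Tj) => -> /eqP.
rewrite mulf_eq0 => /orP [|/eqP //].
by move/eqP/(congr1 (mcoeff U_(j))); rewrite mcoeffXU eqxx mcoeff0 => /eqP; rewrite oner_eq0.
Qed.

End Kill.

Lemma coeff0_sum (k : fieldType) n (p : {mpoly k[n]}) : p@_0 = 0 ->
  exists v : 'I_n -> {mpoly k[n]}, p = \sum_i 'X_i * v i.
Proof.
move=> p0; have [v E] := kill_sub (fun=> true) p; exists v.
rewrite {1}E.
have K0 : (kill (fun=> true) p) = (p@_0)%:MP.
  rewrite /kill; elim/mpolyind: p {p0 E} => [|c m p _ _ IH]; first by rewrite !raddf0.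
  rewrite !raddfD /= IH; congr (_ + _); rewrite !linearZ /= mcoeffX.
  rewrite mpolyXE_id rmorph_prod /= -mul_mpolyC.
  case: (m =P 0%MM) => [->|/eqP m0].
    by rewrite mulr1 big1 ?mulr1 // => i; rewrite mnm0E expr0 rmorph1.
  rewrite mulr0 mpolyC0; have /existsP [i mi] : [exists i, m i != 0%N].
    apply: contraR m0; rewrite negb_exists => /forallP H.
    by apply/eqP/mnmP => i; rewrite mnm0E; apply/eqP/negbNE/H.
  rewrite (bigD1 i) //= rmorphXn /= comp_mpolyXU -tnth_nth tnth_mktuple.
  by rewrite expr0n (negbTE mi) mul0r mulr0.
by rewrite K0 p0 mpolyC0 add0r.
Qed.

Definition i0 : 'I_3 := inord 0.
Definition i1 : 'I_3 := inord 1.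
Definition i2 : 'I_3 := inord 2.

Lemma sum3 (V : nmodType) (F : 'I_3 -> V) : \sum_i F i = F i0 + F i1 + F i2.
Proof.
rewrite !big_ord_recl big_ord0 addr0 addrA.
by congr (F _ + F _ + F _); apply/val_inj; rewrite /= inordK.
Qed.

Section Koszul.
Variable k : fieldType.
Notation P := {mpoly k[3]}.
Notation x0 := ('X_i0 : P).
Notation x1 := ('X_i1 : P).
Notation x2 := ('X_i2 : P).

Lemma sum_i0 (w : 'I_3 -> P) : \sum_(i | i == i0) 'X_i * w i = x0 * w i0.
Proof. by rewrite big_pred1_eq. Qed.

Lemma sum_i01 (w : 'I_3 -> P) :
  \sum_(i | i != i2) 'X_i * w i = x0 * w i0 + x1 * w i1.
Proof.
have E := sum3 (fun i => 'X_i * w i); rewrite (bigD1 i2) //= in E.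
by apply: (addrI (x2 * w i2)); rewrite E; ring.
Qed.

Lemma regular1 (q r : P) : x1 * q = x0 * r -> exists s, q = x0 * s.
Proof.
move=> E; have T1 : ~~ (i1 == i0) by rewrite -val_eqE /= !inordK.
have [|w ->] := @kill_regular k 3 (pred1 i0) i1 q (fun=> r) T1; first by rewrite sum_i0.
by exists (w i0); rewrite sum_i0.
Qed.

Lemma regular2 (e a b : P) : x2 * e = x0 * a + x1 * b ->
  exists c d, e = x0 * c + x1 * d.
Proof.
move=> E; have T2 : ~~ (i2 != i2) by rewrite eqxx.
have ne : i1 != i0 by rewrite -val_eqE /= !inordK.
have [|w ->] := @kill_regular k 3 (predC1 i2) i2 e (fun i => if i == i0 then a else b) T2.
  by rewrite sum_i01 eqxx (negbTE ne).
by exists (w i0), (w i1); rewrite sum_i01.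
Qed.

Lemma mulXI i : injective ( *%R ('X_i : P)).
Proof.
apply/mulfI/eqP => /(congr1 (mcoeff U_(i))).
by rewrite mcoeffXU eqxx mcoeff0 => /eqP; rewrite oner_eq0.
Qed.

(** With K_3 = P mapped to (x0, x1, x2) P and K_2 -> K_1 the cross product with (x0, x1, x2), this
    is exactness of the Koszul complex at K_2. *)
Lemma koszul1 (q0 q1 q2 : P) :
  x1 * q2 = x2 * q1 -> x2 * q0 = x0 * q2 -> x0 * q1 = x1 * q0 ->
  exists p, [/\ q0 = x0 * p, q1 = x1 * p & q2 = x2 * p].
Proof.
move=> E0 E1 E2; have [p Ep] := regular1 (esym E2); exists p; split=> //.
  by apply: (@mulXI i0); rewrite E2 Ep; ring.
by apply: (@mulXI i0); rewrite -E1 Ep; ring.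
Qed.

(** Exactness of the Koszul complex at K_1: a vector orthogonal to (x0, x1, x2) is a cross product
    with it. *)
Lemma koszul2 (e0 e1 e2 : P) : x0 * e0 + x1 * e1 + x2 * e2 = 0 ->
  exists a b c, [/\ e0 = x1 * c - x2 * b, e1 = x2 * a - x0 * c & e2 = x0 * b - x1 * a].
Proof.
move=> E; have [|b [a' Ee2]] := @regular2 e2 (- e0) (- e1).
  by apply: (addrI (x0 * e0 + x1 * e1)); rewrite E; ring.
have E1 : x1 * (e1 + x2 * a') = x0 * (- e0 - x2 * b).
  apply: (addrI (x0 * e0 + x2 * x0 * b)).
  by transitivity (x0 * e0 + x1 * e1 + x2 * e2); [rewrite Ee2 | rewrite E]; ring.
have [c Ec] := regular1 E1.
exists (- a'), b, (- c); split.
- apply: (@mulXI i0); have := E1; rewrite Ec => E3.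
  have -> : x0 * e0 = - (x0 * (- e0 - x2 * b)) - x0 * x2 * b by ring.
  by rewrite -E3; ring.
- by apply: (addIr (x2 * a')); rewrite Ec; ring.
- by rewrite Ee2; ring.
Qed.

Variable n : nat.
Implicit Types q e : 'rV[P]_n.

Lemma scaleXI i : injective ( *:%R ('X_i : P) : 'rV[P]_n -> 'rV[P]_n).
Proof.
by move=> u v /rowP E; apply/rowP => j; have := E j; rewrite !mxE => /mulXI.
Qed.

Lemma koszul1_row q0 q1 q2 :
  x1 *: q2 = x2 *: q1 -> x2 *: q0 = x0 *: q2 -> x0 *: q1 = x1 *: q0 ->
  exists p, [/\ q0 = x0 *: p, q1 = x1 *: p & q2 = x2 *: p].
Proof.
move=> /rowP E0 /rowP E1 /rowP E2.
have [j|p Ep] := fin_all_exists (P := fun (j : 'I_n) p =>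
  [/\ q0 0 j = x0 * p, q1 0 j = x1 * p & q2 0 j = x2 * p]).
  by apply: koszul1; [have := E0 j | have := E1 j | have := E2 j]; rewrite !mxE.
by exists (\row_j p j); split; apply/rowP => j; rewrite !mxE; case: (Ep j).
Qed.

Lemma koszul2_row e0 e1 e2 : x0 *: e0 + x1 *: e1 + x2 *: e2 = 0 ->
  exists a b c, [/\ e0 = x1 *: c - x2 *: b, e1 = x2 *: a - x0 *: c
                  & e2 = x0 *: b - x1 *: a].
Proof.
move=> /rowP E.
have [j|p Ep] := fin_all_exists (P := fun (j : 'I_n) (p : P * P * P) =>
  [/\ e0 0 j = x1 * p.2 - x2 * p.1.2, e1 0 j = x2 * p.1.1 - x0 * p.2
    & e2 0 j = x0 * p.1.2 - x1 * p.1.1]).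
  have [|a [b [c abc]]] := @koszul2 (e0 0 j) (e1 0 j) (e2 0 j).
    by have := E j; rewrite !mxE.
  by exists (a, b, c).
exists (\row_j (p j).1.1), (\row_j (p j).1.2), (\row_j (p j).2).
by split; apply/rowP => j; rewrite !mxE; case: (Ep j).
Qed.

Lemma coeff0_sum_row q : (forall j, (q 0 j)@_0 = 0) ->
  exists v0 v1 v2, q = x0 *: v0 + x1 *: v1 + x2 *: v2.
Proof.
move=> q0.
have [j|v Ev] := fin_all_exists (P := fun (j : 'I_n) (v : 'I_3 -> P) =>
  q 0 j = \sum_i 'X_i * v i); first exact: coeff0_sum.
exists (\row_j v j i0), (\row_j v j i1), (\row_j v j i2).
by apply/rowP => j; rewrite !mxE Ev sum3.
Qed.

End Koszul.

(** * Diagram chases between a complex of free modules and the Koszul complex *)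

Section Chase.
Variable k : fieldType.
Notation P := {mpoly k[3]}.
Notation x0 := ('X_i0 : P).
Notation x1 := ('X_i1 : P).
Notation x2 := ('X_i2 : P).

Variables (n3 n2 n1 n0 : nat).
Variables (D3 : 'M[P]_(n3, n2)) (D2 : 'M[P]_(n2, n1)) (D1 : 'M[P]_(n1, n0)).
Hypothesis exact2 : forall y, y *m D2 = 0 <-> exists w, w *m D3 = y :> 'rV_n2.
Hypothesis exact1 : forall y, y *m D1 = 0 <-> exists w, w *m D2 = y :> 'rV_n1.

Lemma complex32 (w : 'rV_n3) : w *m D3 *m D2 = 0.
Proof. by apply/exact2; exists w. Qed.

Lemma complex21 (w : 'rV_n2) : w *m D2 *m D1 = 0.
Proof. by apply/exact1; exists w. Qed.

(* A chase in the double complex of D and the Koszul complex: Tor_4(-, k) = 0. *)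
Lemma ker_coeff0 (w : 'rV_n3) : w *m D3 = 0 -> (forall j, (w 0 j)@_0 = 0) ->
  exists v0 v1 v2, [/\ v0 *m D3 = 0, v1 *m D3 = 0, v2 *m D3 = 0
                     & w = x0 *: v0 + x1 *: v1 + x2 *: v2].
Proof.
move=> wD /coeff0_sum_row [e0 [e1 [e2 Ew]]].
have := wD; rewrite Ew !mulmxDl -!scalemxAl => /koszul2_row [q0 [q1 [q2 [E0 E1 E2]]]].
have := @complex32 e0; rewrite E0 mulmxBl -!scalemxAl => /eqP; rewrite subr_eq0 => /eqP F0.
have := @complex32 e1; rewrite E1 mulmxBl -!scalemxAl => /eqP; rewrite subr_eq0 => /eqP F1.
have := @complex32 e2; rewrite E2 mulmxBl -!scalemxAl => /eqP; rewrite subr_eq0 => /eqP F2.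
have [p [Q0 Q1 Q2]] := koszul1_row F0 F1 F2.
have pD : p *m D1 = 0.
  by apply: (@scaleXI k n0 i0); rewrite scaler0 scalemxAl -Q0 complex21.
have [r Er] := (exact1 p).1 pD.
have lift q i : q *m D2 = 'X_i *: p -> exists t, t *m D3 = q - 'X_i *: r.
  by move=> Q; apply/exact2; rewrite mulmxBl Q -scalemxAl Er subrr.
have [t0 T0] := lift _ _ Q0; have [t1 T1] := lift _ _ Q1; have [t2 T2] := lift _ _ Q2.
(* Subtracting the cross product of x and t from e keeps the sum of the x_i e_i and, as t_i is sent
   to q_i - x_i r, makes every component a cycle. *)
exists (e0 - (x1 *: t2 - x2 *: t1)), (e1 - (x2 *: t0 - x0 *: t2)),
  (e2 - (x0 *: t1 - x1 *: t0)); split.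
- rewrite !mulmxBl -!scalemxAl E0 T1 T2; apply/rowP => j; rewrite !mxE; ring.
- rewrite !mulmxBl -!scalemxAl E1 T0 T2; apply/rowP => j; rewrite !mxE; ring.
- rewrite !mulmxBl -!scalemxAl E2 T1 T0; apply/rowP => j; rewrite !mxE; ring.
- apply/rowP => j; rewrite !mxE; ring.
Qed.

End Chase.

(* [koszul_link w p]: w in C_3 and p in C_0 are joined by the connecting maps of
   the double complex of C and the Koszul complex, which induce the isomorphism
   of Tor_3(C_0/im C_1, k) with the socle of C_0/im C_1. *)
Section Link.
Variable k : fieldType.
Notation P := {mpoly k[3]}.
Notation x0 := ('X_i0 : P).
Notation x1 := ('X_i1 : P).
Notation x2 := ('X_i2 : P).
Variables (n3 n2 n1 n0 : nat).
Variables (D3 : 'M[P]_(n3, n2)) (D2 : 'M[P]_(n2, n1)) (D1 : 'M[P]_(n1, n0)).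
Hypothesis exact2 : forall y, y *m D2 = 0 <-> exists w, w *m D3 = y :> 'rV_n2.
Hypothesis exact1 : forall y, y *m D1 = 0 <-> exists w, w *m D2 = y :> 'rV_n1.

Definition koszul_link (w : 'rV[P]_n3) (p : 'rV[P]_n0) :=
  exists e0 e1 e2 q0 q1 q2,
    [/\ w *m D3 = x0 *: e0 + x1 *: e1 + x2 *: e2,
        e0 *m D2 = x1 *: q2 - x2 *: q1, e1 *m D2 = x2 *: q0 - x0 *: q2,
        e2 *m D2 = x0 *: q1 - x1 *: q0
      & [/\ q0 *m D1 = x0 *: p, q1 *m D1 = x1 *: p & q2 *m D1 = x2 *: p]].

(** At each stage the Koszul differential of the elements already lifted is a cycle of the complex,
    so exactness provides the next lift. *)
Lemma koszul_link_ex p :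
  (forall i, exists q, q *m D1 = 'X_i *: p) -> exists w, koszul_link w p.
Proof.
move=> H; have [q0 Q0] := H i0; have [q1 Q1] := H i1; have [q2 Q2] := H i2.
have lift i j q q' : q *m D1 = 'X_i *: p -> q' *m D1 = 'X_j *: p ->
  exists e, e *m D2 = 'X_i *: q' - 'X_j *: q.
  move=> Q Q'; apply/exact1; rewrite mulmxBl -!scalemxAl Q Q'.
  by apply/rowP => l; rewrite !mxE; ring.
have [e0 E0] := lift _ _ _ _ Q1 Q2; have [e1 E1] := lift _ _ _ _ Q2 Q0.
have [e2 E2] := lift _ _ _ _ Q0 Q1.
have /exact2 [w Ew] : (x0 *: e0 + x1 *: e1 + x2 *: e2) *m D2 = 0.
  rewrite !mulmxDl -!scalemxAl E0 E1 E2; apply/rowP => l; rewrite !mxE; ring.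
by exists w, e0, e1, e2, q0, q1, q2.
Qed.

(** Injectivity of the passage from the socle to constant terms. If w is a Koszul boundary,
    correcting the e_i and then the q_i by boundaries turns the q_i into x_i z, and z is a preimage
    of p. *)
Lemma koszul_link_coeff0 w p : koszul_link w p -> (forall j, (w 0 j)@_0 = 0) ->
  exists z, z *m D1 = p.
Proof.
move=> [e0 [e1 [e2 [q0 [q1 [q2 [Ew E0 E1 E2 [Q0 Q1 Q2]]]]]]]].
move=> /coeff0_sum_row [v0 [v1 [v2 Ev]]].
have : x0 *: (e0 - v0 *m D3) + x1 *: (e1 - v1 *m D3) + x2 *: (e2 - v2 *m D3) = 0.
  transitivity (w *m D3 - (x0 *: v0 + x1 *: v1 + x2 *: v2) *m D3).
    rewrite Ew !mulmxDl -!scalemxAl; move: (v0 *m D3) (v1 *m D3) (v2 *m D3) => a b c.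
    by apply/rowP => l; rewrite !mxE; ring.
  by rewrite -Ev subrr.
move=> /koszul2_row [y0 [y1 [y2 [Y0 Y1 Y2]]]].
have c32 := complex32 exact2.
have [z [Z0 Z1 Z2]] : exists z, [/\ q0 - y0 *m D2 = x0 *: z,
    q1 - y1 *m D2 = x1 *: z & q2 - y2 *m D2 = x2 *: z].
  apply: koszul1_row; apply/eqP; rewrite -subr_eq0; apply/eqP.
  - transitivity ((e0 - v0 *m D3 - (x1 *: y2 - x2 *: y1)) *m D2).
      rewrite !mulmxBl c32 E0 -!scalemxAl; apply/rowP => l; rewrite !mxE; ring.
    by rewrite Y0 subrr mul0mx.
  - transitivity ((e1 - v1 *m D3 - (x2 *: y0 - x0 *: y2)) *m D2).
      rewrite !mulmxBl c32 E1 -!scalemxAl; apply/rowP => l; rewrite !mxE; ring.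
    by rewrite Y1 subrr mul0mx.
  - transitivity ((e2 - v2 *m D3 - (x0 *: y1 - x1 *: y0)) *m D2).
      rewrite !mulmxBl c32 E2 -!scalemxAl; apply/rowP => l; rewrite !mxE; ring.
    by rewrite Y2 subrr mul0mx.
exists z; apply: (@scaleXI k n0 i0).
by rewrite scalemxAl -Z0 mulmxBl (complex21 exact1) subr0.
Qed.

Lemma koszul_linkD w p w' p' :
  koszul_link w p -> koszul_link w' p' -> koszul_link (w + w') (p + p').
Proof.
move=> [e0 [e1 [e2 [q0 [q1 [q2 [Ew E0 E1 E2 [Q0 Q1 Q2]]]]]]]].
move=> [e0' [e1' [e2' [q0' [q1' [q2' [Ew' E0' E1' E2' [Q0' Q1' Q2']]]]]]]].
exists (e0 + e0'), (e1 + e1'), (e2 + e2'), (q0 + q0'), (q1 + q1'), (q2 + q2').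
split; [| | | |split]; rewrite mulmxDl ?Ew ?Ew' ?E0 ?E0' ?E1 ?E1' ?E2 ?E2'
  ?Q0 ?Q0' ?Q1 ?Q1' ?Q2 ?Q2' -?scalerDr //;
  by apply/rowP => l; rewrite !mxE; ring.
Qed.

Lemma koszul_linkZ c w p : koszul_link w p -> koszul_link (c *: w) (c *: p).
Proof.
move=> [e0 [e1 [e2 [q0 [q1 [q2 [Ew E0 E1 E2 [Q0 Q1 Q2]]]]]]]].
exists (c *: e0), (c *: e1), (c *: e2), (c *: q0), (c *: q1), (c *: q2).
split; [| | | |split]; rewrite -scalemxAl ?Ew ?E0 ?E1 ?E2 ?Q0 ?Q1 ?Q2;
  by apply/rowP => l; rewrite !mxE; ring.
Qed.

Lemma koszul_link_comb m (c : 'I_m -> P) (w : 'I_m -> 'rV_n3) (p : 'I_m -> 'rV_n0) :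
  (forall i, koszul_link (w i) (p i)) ->
  koszul_link (\sum_i c i *: w i) (\sum_i c i *: p i).
Proof.
move=> H; apply: (big_ind2 koszul_link) => [|????|i _].
- by exists 0, 0, 0, 0, 0, 0; rewrite !mul0mx !scaler0 !addr0 subr0.
- exact: koszul_linkD.
- exact: koszul_linkZ.
Qed.

End Link.

(** * Graded maps between free modules *)

Section HomogeneousMatrices.
Variables (k : fieldType) (n : nat).
Notation P := {mpoly k[n]}.

(* The map from the sum of the P(- t u) to the sum of the P(- t' v) given by D
   has degree 0. *)
Definition hmx m m' (t : 'I_m -> int) (t' : 'I_m' -> int) (D : 'M[P]_(m, m')) :=
  forall u v, ishom (t u - t' v) (D u v).

(** The component of degree 0 of a map. It is compatible with composition by homogeneous maps, so a
    solution of a homogeneous linear equation can be replaced by a homogeneous one. *)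
Definition hpart m m' (t : 'I_m -> int) (t' : 'I_m' -> int) (D : 'M[P]_(m, m')) :
  'M[P]_(m, m') := \matrix_(u, v) hcomp (t u - t' v) (D u v).

Lemma hpart_hmx m m' (t : 'I_m -> int) (t' : 'I_m' -> int) D : hmx t t' (hpart t t' D).
Proof. by move=> u v; rewrite mxE; apply: hcomp_hom. Qed.

Lemma hpart_id m m' (t : 'I_m -> int) (t' : 'I_m' -> int) D : hmx t t' D -> hpart t t' D = D.
Proof. by move=> H; apply/matrixP => u v; rewrite mxE; apply: H. Qed.

Lemma hpartD m m' (t : 'I_m -> int) (t' : 'I_m' -> int) D E :
  hpart t t' (D + E) = hpart t t' D + hpart t t' E.
Proof. by apply/matrixP => u v; rewrite !mxE raddfD. Qed.

Lemma hpart0 m m' (t : 'I_m -> int) (t' : 'I_m' -> int) : hpart t t' 0 = 0.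
Proof. by apply/matrixP => u v; rewrite !mxE raddf0. Qed.

Lemma hpartMr m m' m'' (t : 'I_m -> int) (t' : 'I_m' -> int) (t'' : 'I_m'' -> int) A B :
  hmx t' t'' B -> hpart t t'' (A *m B) = hpart t t' A *m B.
Proof.
move=> H; apply/matrixP => u v; rewrite !mxE raddf_sum; apply: eq_bigr => w _ /=.
by rewrite mxE mulrC (hcompMl _ _ (H w v)) mulrC; congr (hcomp _ _ * _); ring.
Qed.

Lemma hmxM m m' m'' (t : 'I_m -> int) (t' : 'I_m' -> int) (t'' : 'I_m'' -> int) A B :
  hmx t t' A -> hmx t' t'' B -> hmx t t'' (A *m B).
Proof.
by move=> hA hN; rewrite -(hpart_id hA) -(hpartMr _ _ hN); apply: hpart_hmx.
Qed.

Lemma hpartXl m m' (t : 'I_m -> int) (t' : 'I_m' -> int) i D :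
  hpart t t' ('X_i *: D) = 'X_i *: hpart (fun u => t u - 1) t' D.
Proof.
apply/matrixP => u v; rewrite !mxE hcompXl.
by congr (_ * hcomp _ _); ring.
Qed.

End HomogeneousMatrices.

(* The shift by 3 is that of the last term of the Koszul complex. *)
Lemma koszul_link_hpart (k : fieldType) n3 n2 n1 n0
    (D3 : 'M[{mpoly k[3]}]_(n3, n2)) (D2 : 'M_(n2, n1)) (D1 : 'M_(n1, n0))
    (t3 : 'I_n3 -> int) (t2 : 'I_n2 -> int) (t1 : 'I_n1 -> int) (t0 : 'I_n0 -> int)
    (z : int) w p :
  hmx t3 t2 D3 -> hmx t2 t1 D2 -> hmx t1 t0 D1 -> koszul_link D3 D2 D1 w p ->
  koszul_link D3 D2 D1 (hpart (fun=> z + 3) t3 w) (hpart (fun=> z) t0 p).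
Proof.
move=> h3 h2 h1 [e0 [e1 [e2 [q0 [q1 [q2 [Ew E0 E1 E2 [Q0 Q1 Q2]]]]]]]].
pose e' (e : 'rV[{mpoly k[3]}]_n2) := hpart (fun=> z + 2) t2 e.
pose q' (q : 'rV[{mpoly k[3]}]_n1) := hpart (fun=> z + 1) t1 q.
have hN m (t : 'I_m -> int) y (a : 'rV[{mpoly k[3]}]_m) :
    hpart (fun=> y) t (- a) = - hpart (fun=> y) t a.
  by apply/rowP => j; rewrite !mxE raddfN.
have hX m (t : 'I_m -> int) y y' (i : 'I_3) (a : 'rV[{mpoly k[3]}]_m) : y = y' + 1 ->
    hpart (fun=> y) t ('X_i *: a) = 'X_i *: hpart (fun=> y') t a.
  by move=> ->; rewrite hpartXl; congr (_ *: _); apply/rowP => j; rewrite !mxE addrK.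
have z3 : z + 3 = z + 2 + 1 by ring.
have z2 : z + 2 = z + 1 + 1 by ring.
exists (e' e0), (e' e1), (e' e2), (q' q0), (q' q1), (q' q2).
rewrite /koszul_link /e' /q'.
split; [| | | |split];
  rewrite -?(hpartMr _ _ h3) -?(hpartMr _ _ h2) -?(hpartMr _ _ h1) ?Ew ?E0 ?E1 ?E2 ?Q0 ?Q1 ?Q2
    ?hpartD ?hN ?(hX _ _ _ _ _ _ z3) ?(hX _ _ _ _ _ _ z2) ?(hX _ _ _ _ _ _ erefl) //.
Qed.

(** * Matrix factorizations *)

(** Equality of two multisets of shifts; the bijection avoids a cast between ranks that are only
    provably equal. *)
Definition same_shifts m m' (t : 'I_m -> int) (t' : 'I_m' -> int) : Prop :=
  exists s : 'I_m -> 'I_m', bijective s /\ forall u, t u = t' (s u).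

Lemma same_shifts_sym m m' (t : 'I_m -> int) (t' : 'I_m' -> int) :
  same_shifts t t' -> same_shifts t' t.
Proof.
move=> [s [[r sr rs] H]]; exists r; split; first by exists s.
by move=> u; rewrite H rs.
Qed.

Lemma same_shifts_trans m m' m'' (t : 'I_m -> int) (t' : 'I_m' -> int)
    (t'' : 'I_m'' -> int) :
  same_shifts t t' -> same_shifts t' t'' -> same_shifts t t''.
Proof.
move=> [s [bs H]] [s' [bs' H']]; exists (s' \o s); split; first exact: bij_comp.
by move=> u; rewrite H H'.
Qed.

Lemma unit_same_shifts (K : fieldType) m (t t' : 'I_m -> int) (A : 'M[K]_m) :
  A \in unitmx -> (forall u v, A u v != 0 -> t u = t' v) -> same_shifts t t'.
Proof.
move=> uA tA.
have [s Hs] : exists s : 'S_m, \prod_i A i (s i) != 0.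
  apply/existsP; apply: contraTT uA; rewrite negb_exists => /forallP H.
  rewrite unitmxE unitfE negbK /determinant big1 // => s _.
  by have /negbNE/eqP -> := H s; rewrite mulr0.
exists s; split; first by exists (s^-1)%g; [exact: permK | exact: permKV].
by move=> u; apply: tA; move/prodf_neq0: Hs; apply.
Qed.

Lemma inverse_same_shifts (K : fieldType) m m' (t : 'I_m -> int) (t' : 'I_m' -> int)
    (A : 'M[K]_(m, m')) B : A *m B = 1%:M -> B *m A = 1%:M ->
  (forall u v, A u v != 0 -> t u = t' v) -> same_shifts t t'.
Proof.
move=> AB BA; have mm : m = m'.
  by apply/eqP; rewrite eqn_leq (mulmx1_min AB) (mulmx1_min BA).
subst m'; apply: unit_same_shifts; exact: (mulmx1_unit AB).1.
Qed.

Section Isomorphisms.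
Variables (k : fieldType) (n : nat) (A : comPzRingType) (pi : {mpoly k[n]} -> A).

Lemma same_shifts_twist_iso m m' (t : 'I_m -> int) (t' : 'I_m' -> int) e :
  same_shifts t (fun v => t' v - e) ->
  gm_iso (gm_free pi t) (gm_twist (gm_free pi t') e).
Proof.
move=> [s [[r sr rs] H]].
pose phi (x : 'rV[A]_m) : 'rV[A]_m' := \row_v x 0 (r v).
have lin : linear phi by move=> c x y; apply/rowP => v; rewrite !mxE.
pose L := GRing.isLinear.Build A 'rV[A]_m 'rV[A]_m' *:%R phi lin.
pose phiL : {linear 'rV[A]_m -> 'rV[A]_m'} := HB.pack phi L.
have bphi : bijective phi.
  by exists (fun y : 'rV[A]_m' => \row_u y 0 (s u)) => x; apply/rowP => u; rewrite !mxE ?sr ?rs.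
exists phiL; split; first exact: bphi.
move=> z x; split=> [Hx v | Hx u] /=.
  rewrite mxE; have := Hx (r v); rewrite H rs.
  by have -> : - (t' v - e) + z = - t' v + (e + z) by ring.
have := Hx (s u); rewrite /= mxE sr H.
by have -> : - (t' (s u) - e) + z = - t' (s u) + (e + z) by ring.
Qed.

Lemma same_shifts_iso m m' (t : 'I_m -> int) (t' : 'I_m' -> int) :
  same_shifts t t' -> gm_iso (gm_free pi t) (gm_free pi t').
Proof.
move=> [s [bs H]]; have [] := @same_shifts_twist_iso _ _ t t' 0.
  by exists s; split=> // u; rewrite H subr0.
move=> phi [bphi Hphi]; exists phi; split=> // z x.
by rewrite Hphi /= add0r.
Qed.

End Isomorphisms.

Section Units.
Variables (k : fieldType) (n : nat).
Notation P := {mpoly k[n]}.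
Notation ev := (map_mx (mcoeff (0%MM : 'X_{1..n}))).

(** In each term of the expansion the degrees t i - t (s i) add up to 0, s being a permutation. *)
Lemma det_ishom m (t : 'I_m -> int) (U : 'M[P]_m) : hmx t t U -> ishom 0 (\det U).
Proof.
move=> hU; apply: ishom_sum => s _.
have -> : 0 = 0 + \sum_i (t i - t (s i)).
  rewrite add0r sumrB [X in X - _](reindex_inj (@perm_inj _ s)) /= subrr //.
apply: ishomM; last first.
  elim/big_rec2: _ => [|i y z _ h]; first by rewrite -mpolyC1; apply: ishomC.
  exact: ishomM.
by case: odd_perm; rewrite ?expr1 ?expr0 -mpolyC1; [apply: ishomN|]; apply: ishomC.
Qed.

(** The determinant has degree 0, so it is a constant and can be computed at the origin; the
    adjugate is then the inverse. *)
Lemma hmx_unit m (t : 'I_m -> int) (U : 'M[P]_m) :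
  hmx t t U -> ev U = 1%:M -> exists V, V *m U = 1%:M /\ U *m V = 1%:M.
Proof.
move=> hU eU; have dU : \det U = 1.
  rewrite (ishom_const (det_ishom hU) erefl).
  by rewrite -(det_map_mx (mcoeff (0%MM : 'X_{1..n}))) eU det1 mpolyC1.
by exists (\adj U); rewrite mul_adj_mx mul_mx_adj dU.
Qed.

End Units.

Lemma rows_mx (A : comPzRingType) m m' n (B : 'M[A]_(m, n)) (C : 'M[A]_(m', n)) :
  (forall u, exists x, x *m B = row u C) -> exists X, X *m B = C.
Proof.
move=> /fin_all_exists [x Hx]; exists (\matrix_u x u).
by apply/row_matrixP => u; rewrite row_mul rowK.
Qed.

Lemma fin_mx (T : Type) m n (Q : 'I_m -> 'I_n -> T -> Prop) :
  (forall u v, exists p, Q u v p) ->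
  exists M : 'M[T]_(m, n), forall u v, Q u v (M u v).
Proof.
move=> H; have [u|M HM] := @fin_all_exists _ _
  (fun (u : 'I_m) (r : 'I_n -> T) => forall v, Q u v (r v)).
  exact: fin_all_exists.
by exists (\matrix_(u, v) M u v) => u v; rewrite mxE.
Qed.

Lemma coeff0_irrelevant (k : fieldType) n (A : comPzRingType)
    (pi : {rmorphism {mpoly k[n]} -> A}) :
  (forall y, exists p, pi p = y) -> (forall p, pi p = 0 -> p@_0 = 0) ->
  forall p, irrelevant_ideal pi (pi p) -> p@_0 = 0.
Proof.
move=> surj ker p [m [c [g [Hg E]]]].
have [c' Hc] := fin_all_exists (fun i => surj (c i)).
have [j Hj] := fin_all_exists Hg.
have E' : pi (p - \sum_i c' i * 'X_(j i)) = 0.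
  rewrite raddfB /= E raddf_sum -sumrB big1 // => i _ /=.
  by rewrite rmorphM /= Hc Hj subrr.
have /eqP := ker _ E'; rewrite mcoeffB subr_eq0 => /eqP ->.
rewrite raddf_sum big1 // => i _ /=.
by rewrite rmorphM /= mcoeffX mnm1_eq0 mulr0.
Qed.

Section Hypersurface.
Variables (k : fieldType) (n : nat).
Notation P := {mpoly k[n]}.
Notation ev := (map_mx (mcoeff (0%MM : 'X_{1..n}))).
Variables (f : P) (d : nat) (R : comPzRingType) (pi : {rmorphism P -> R}).
Hypotheses (f_neq0 : f != 0) (f_hom : ishom d f) (f0 : f@_0 = 0).
Hypothesis pi_surj : forall y, exists p, pi p = y.
Hypothesis pi_ker : forall p, pi p = 0 <-> exists c, p = c * f.

Lemma coeff0_irr p : irrelevant_ideal pi (pi p) -> p@_0 = 0.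
Proof.
apply: coeff0_irrelevant => // q /pi_ker [c ->].
by rewrite rmorphM /= f0 mulr0.
Qed.

Lemma pi_ker_mx m m' (M : 'M[P]_(m, m')) :
  map_mx pi M = 0 <-> exists C, M = f *: C.
Proof.
split=> [/matrixP E | [C ->]].
  have [u v|C HC] := @fin_mx _ m m' (fun u v c => M u v = c * f).
    by apply/pi_ker; have := E u v; rewrite !mxE.
  by exists C; apply/matrixP => u v; rewrite mxE HC mulrC.
apply/matrixP => u v; rewrite !mxE; apply/pi_ker.
by exists (C u v); rewrite mulrC.
Qed.

Lemma pi_lift_mx m m' (M : 'M[R]_(m, m')) : exists M', map_mx pi M' = M.
Proof.
have [u v|C HC] := @fin_mx _ m m' (fun u v c => pi c = M u v); first exact: pi_surj.
by exists C; apply/matrixP => u v; rewrite mxE.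
Qed.

Lemma fZI m m' : injective ( *:%R f : 'M[P]_(m, m') -> 'M_(m, m')).
Proof.
move=> A B /matrixP E; apply/matrixP => u v.
by have := E u v; rewrite !mxE => /(mulfI f_neq0).
Qed.

(** Modulo f, the relations between the rows of [Phi] are the combinations of the rows of [Psi]; the
    last condition thus says that the rows of [Phi] are minimal generators of their span over R. *)
Definition matrix_factorization m m' (t : 'I_m -> int) (t' : 'I_m' -> int)
    (Phi : 'M[P]_(m, m')) (Psi : 'M[P]_(m', m)) :=
  [/\ hmx t t' Phi, hmx (fun v => t' v + d) t Psi, Phi *m Psi = f%:M,
      Psi *m Phi = f%:M & ev Psi = 0].

Lemma hpartZf m m' (t : 'I_m -> int) (t' : 'I_m' -> int) M :
  hpart t t' (f *: M) = f *: hpart (fun u => t u - d%:Z) t' M.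
Proof.
apply/matrixP => u v; rewrite !mxE (hcompMl _ _ f_hom).
by congr (_ * hcomp _ _); ring.
Qed.

Lemma row_mod_f m m' n' (D : 'M[P]_(m, n')) (D' : 'M[P]_(m', n')) t t' (s : 'I_n' -> int) :
  hmx t s D -> hmx t' s D' ->
  (forall u, exists x, x *m map_mx pi D' = row u (map_mx pi D)) ->
  exists A C, hmx t t' A /\ D = A *m D' + f *: C.
Proof.
move=> hD hD' /rows_mx [X HX]; have [A0 HA0] := pi_lift_mx X.
have /pi_ker_mx [C0 HC] : map_mx pi (D - A0 *m D') = 0.
  by rewrite map_mxB map_mxM HA0 HX subrr.
exists (hpart t t' A0), (hpart (fun u => t u - d%:Z) s C0); split; first exact: hpart_hmx.
rewrite -hpartZf -HC -{1}(hpart_id hD) -(hpartMr _ _ hD') -hpartD.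
by rewrite addrC subrK.
Qed.

(* Phi' = A Phi with A homogeneous of degree 0 and invertible at 0, hence
   invertible, so that Psi A^-1 is a cofactor of Phi'. *)
Lemma matrix_factorization_transfer m m' n' (a : 'I_m -> int) (a' : 'I_m' -> int)
    (t : 'I_n' -> int) Phi Psi (Phi' : 'M[P]_(m', n')) :
  matrix_factorization a t Phi Psi -> hmx a' t Phi' ->
  (forall y : 'rV_n', (exists x, x *m map_mx pi Phi' = y) <->
             (exists x, x *m map_mx pi Phi = y)) ->
  (forall x : 'rV_m', x *m map_mx pi Phi' = 0 -> forall j, irrelevant_ideal pi (x 0 j)) ->
  same_shifts a' a /\ exists Psi', matrix_factorization a' t Phi' Psi'.
Proof.
move=> [hPhi hPsi PhiPsi PsiPhi ePsi] hPhi' im ker.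
have row_im m0 n0 (M : 'M[R]_(m0, n0)) u : exists x, x *m M = row u M.
  by exists (delta_mx 0 u); rewrite -rowE.
have [u|A0 [C0 [hA0 EA0]]] := row_mod_f hPhi' hPhi; first by apply/im.
have [u|B [C [hB EB]]] := row_mod_f hPhi hPhi'; first by apply/im.
have PhiI m0 (X : 'M_(m0, m)) : X *m Phi = 0 -> X = 0.
  move=> X0; apply: (@fZI m0 m); rewrite scaler0 -mul_mx_scalar -PhiPsi mulmxA X0.
  by rewrite mul0mx.
have fE m0 (X : 'M_(m0, n')) : f *: X = X *m Psi *m Phi.
  by rewrite -mulmxA PsiPhi mul_mx_scalar.
(* The error term f C0 is C0 Psi Phi, so it is absorbed into the coefficient of Phi. *)
have [A [hA EA]] : exists A, hmx a' a A /\ Phi' = A *m Phi.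
  exists (hpart a' a (A0 + C0 *m Psi)); split; first exact: hpart_hmx.
  by rewrite -(hpartMr _ _ hPhi) mulmxDl -fE -EA0 hpart_id.
have BA : B *m A = 1%:M - C *m Psi.
  apply/eqP; rewrite -subr_eq0; apply/eqP/PhiI.
  by rewrite !mulmxBl mul1mx -mulmxA -EA -fE EB addrK subrr.
have eBA : ev B *m ev A = 1%:M by rewrite -map_mxM BA map_mxB map_mxM ePsi mulmx0 subr0 map_mx1.
(* A B - 1 sends Phi' to 0 modulo f, and [ker] puts such relations in the irrelevant ideal. *)
have eAB : ev A *m ev B = 1%:M.
  rewrite -map_mxM; apply/eqP; rewrite -subr_eq0; apply/eqP/matrixP => u v.
  have E : map_mx pi ((A *m B - 1%:M) *m Phi') = 0.
    apply/pi_ker_mx; exists (- A *m C).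
    rewrite mulmxBl mul1mx {2}EA EB mulmxDr mulmxA -scalemxAr opprD addrA subrr sub0r.
    by rewrite mulNmx scalerN.
  have := @ker (row u (map_mx pi (A *m B - 1%:M))).
  rewrite -row_mul -map_mxM E row0 => /(_ erefl v).
  rewrite mxE mxE => /coeff0_irr E0; rewrite [RHS]mxE -E0.
  by rewrite -(map_mx1 (mcoeff (0%MM : 'X_{1..n}))) -map_mxB mxE.
split.
  apply: (inverse_same_shifts eAB eBA) => u v; rewrite mxE => H.
  by have /eqP := ishom_coeff0 (hA u v) H; rewrite subr_eq0 => /eqP.
have [V1 [V1BA _]] : exists V, V *m (B *m A) = 1%:M /\ (B *m A) *m V = 1%:M.
  by apply: (hmx_unit (hmxM hB hA)); rewrite map_mxM.
have [V2 [_ ABV2]] : exists V, V *m (A *m B) = 1%:M /\ (A *m B) *m V = 1%:M.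
  by apply: (hmx_unit (hmxM hA hB)); rewrite map_mxM.
pose A' := V1 *m B.
have A'A : A' *m A = 1%:M by rewrite -mulmxA.
have AA' : A *m A' = 1%:M.
  have : A *m A' *m (A *m B *m V2) = A *m (A' *m A) *m (B *m V2) by rewrite !mulmxA.
  by rewrite ABV2 A'A !mulmx1 => ->; rewrite mulmxA.
exists (Psi *m A'); have E1 : Phi' *m (Psi *m A') = f%:M.
  rewrite EA -mulmxA (mulmxA Phi) PhiPsi mul_scalar_mx -scalemxAr AA'.
  by rewrite scale_scalar_mx mulr1.
have E2 : Psi *m A' *m Phi' = f%:M.
  by rewrite EA -mulmxA (mulmxA A') A'A mul1mx.
split=> //; last by rewrite map_mxM ePsi mul0mx.
(* The homogeneous part of Psi A' is again a left cofactor of Phi', and this cofactor is unique. *)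
suff <- : hpart (fun v => t v + d) a' (Psi *m A') = Psi *m A' by apply: hpart_hmx.
have E3 : hpart (fun v => t v + d) a' (Psi *m A') *m Phi' = f%:M.
  rewrite -(hpartMr _ _ hPhi') E2 -PsiPhi hpart_id //; exact: hmxM hPsi hPhi.
apply: (@fZI n' m'); rewrite -[LHS]mul_mx_scalar -E1 (mulmxA _ Phi') E3.
by rewrite mul_scalar_mx.
Qed.

End Hypersurface.

(** * Ideals containing a regular sequence of length three *)

Section IdealGen.
Variable A : comPzRingType.
Implicit Types (X I : A -> Prop).

Lemma ideal_gen0 X : ideal_gen X 0.
Proof. by exists 0%N, (fun=> 0), (fun=> 0); split; [case | rewrite big_ord0]. Qed.

Lemma ideal_genD X x y : ideal_gen X x -> ideal_gen X y -> ideal_gen X (x + y).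
Proof.
move=> [n [c [g [Hg ->]]]] [m [c' [g' [Hg' ->]]]].
exists (n + m)%N, (fun i => match split i with inl j => c j | inr j => c' j end),
  (fun i => match split i with inl j => g j | inr j => g' j end).
split=> [i|]; first by case: (split i).
rewrite big_split_ord /=; congr (_ + _); apply: eq_bigr => i _.
  by rewrite (unsplitK (inl i)).
by rewrite (unsplitK (inr i)).
Qed.

Lemma ideal_genM X c x : ideal_gen X x -> ideal_gen X (c * x).
Proof.
move=> [n [b [g [Hg ->]]]]; exists n, (fun i => c * b i), g; split=> //.
by rewrite mulr_sumr; apply: eq_bigr => i _; rewrite mulrA.
Qed.

Lemma ideal_gen_mem (X : A -> Prop) x : X x -> ideal_gen X x.
Proof.
by move=> Xx; exists 1%N, (fun=> 1), (fun=> x); split=> //; rewrite big_ord1 mul1r.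
Qed.

Lemma ideal_gen_sub X (Y : A -> Prop) x : is_ideal Y -> (forall y, X y -> Y y) ->
  ideal_gen X x -> Y x.
Proof.
move=> [Y0 YD YM] XY [n [c [g [Hg ->]]]].
by elim/big_ind: _ => // i _; apply/YM/XY.
Qed.

Lemma ideal_sum I J (r : seq J) (Q : pred J) (F : J -> A) : is_ideal I ->
  (forall i, Q i -> I (F i)) -> I (\sum_(i <- r | Q i) F i).
Proof. by move=> [I0 ID _] H; elim/big_ind: _. Qed.

Lemma ideal_opp I x : is_ideal I -> I x -> I (- x).
Proof. by move=> [_ _ IM] Ix; rewrite -mulN1r; apply: IM. Qed.

Lemma ideal_sub I x y : is_ideal I -> I x -> I y -> I (x - y).
Proof. by move=> idI Ix Iy; case: (idI) => _ ID _; apply: ID => //; apply: ideal_opp. Qed.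

Lemma ideal_mulr I x y : is_ideal I -> I x -> I (x * y).
Proof. by move=> [_ _ IM] Ix; rewrite mulrC; apply: IM. Qed.

End IdealGen.

Section Independence.
Variables (k : fieldType) (n : nat).
Notation P := {mpoly k[n]}.

Definition independent_mod (T : finType) (Q : P -> Prop) (v : T -> P) :=
  forall c : T -> k, Q (\sum_i c i *: v i) -> forall i, c i = 0.

(** [Q'] stands for Q + (a). Modulo it only the terms of exponent 0 survive, so their coefficients
    vanish; what remains is divisible by a, which is cancelled modulo [Q] before the induction on N
    continues. *)
Lemma independent_mod_regular (T : finType) (Q Q' : P -> Prop) (a : P) (v : T -> P) N :
  (forall x c, Q x -> Q' (x + a * c)) -> (forall x, Q (a * x) -> Q x) ->
  independent_mod Q' v ->
  independent_mod Q (fun ij : T * 'I_N => a ^+ ij.2 * v ij.1).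
Proof.
move=> QQ' reg indv c.
rewrite (eq_bigr (fun ij => c (ij.1, ij.2) *: (a ^+ ij.2 * v ij.1))); last by case.
rewrite -(pair_bigA _ (fun i (j : 'I_N) => c (i, j) *: (a ^+ j * v i))) /=.
rewrite exchange_big /= => H ij.
suff {ij} : forall i j, c (i, j) = 0 by case: ij.
elim: N c H => [|N IH] c H i j; first by case: j.
rewrite big_ord_recl /= in H.
pose rest := \sum_(j < N) \sum_i c (i, lift ord0 j) *: (a ^+ j * v i).
have restE : \sum_(j < N) \sum_i c (i, lift ord0 j) *: (a ^+ bump 0 j * v i) = a * rest.
  rewrite mulr_sumr; apply: eq_bigr => l _; rewrite mulr_sumr; apply: eq_bigr => i' _.
  by rewrite -scalerAr mulrA -exprS.
rewrite restE in H.
have c0 i' : c (i', ord0) = 0.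
  apply: (indv (fun i' => c (i', ord0))).
  have := QQ' _ (- rest) H; rewrite mulrN addrK.
  by under eq_bigr do rewrite expr0 mul1r.
rewrite big1 in H; last by move=> i' _; rewrite c0 scale0r.
rewrite add0r in H; have := reg _ H => H'.
case: (unliftP ord0 j) => [j'|] -> //.
exact: (IH (fun ij => c (ij.1, lift ord0 ij.2))).
Qed.

Lemma card_monomials D : (#|{: 'X_{1..n < D}}| <= D ^ n)%N.
Proof.
pose F (m : 'X_{1..n < D}) : {ffun 'I_n -> 'I_D} :=
  [ffun i => Ordinal (leq_ltn_trans (leq_trans (leq_addr _ _)
     (eq_leq (esym (etrans (mdegE m) (bigD1 i isT))))) (bmdeg m))].
rewrite -[X in (D ^ X)%N](card_ord n) -[X in (X ^ _)%N](card_ord D) -card_ffun.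
apply: (@leq_card _ _ F) => m m' /ffunP E; apply/val_inj/mnmP => i.
by have := E i; rewrite !ffunE => /(congr1 val).
Qed.

Lemma independent_card (T : finType) (Q : P -> Prop) (v : T -> P) D :
  Q 0 -> independent_mod Q v -> (forall i, (msize (v i) <= D)%N) ->
  (#|T| <= D ^ n)%N.
Proof.
move=> Q0 ind sz; apply: leq_trans (card_monomials D); rewrite leqNgt; apply/negP => lt.
pose M := \matrix_(i < #|T|, j < #|{: 'X_{1..n < D}}|)
  (v (enum_val i))@_(enum_val j : 'X_{1..n < D}).
have : kermx M != 0.
  rewrite -mxrank_eq0 mxrank_ker -lt0n subn_gt0.
  exact: leq_ltn_trans (rank_leq_col M) lt.
case/rowV0Pn => c /sub_kermxP cM /rV0Pn [i ci]; case/eqP: ci.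
rewrite -(ind (fun x => c 0 (enum_rank x)) _ (enum_val i)) ?enum_valK //.
suff -> : \sum_i c 0 (enum_rank i) *: v i = 0 by [].
apply/mpolyP => m; rewrite mcoeff0 raddf_sum /=.
case: (ltnP (mdeg m) D) => [lt_m|ge_m].
  have /rowP/(_ (enum_rank (BMultinom lt_m))) := cM; rewrite !mxE => E0; rewrite -[RHS]E0.
  rewrite [RHS](reindex _ (onW_bij _ (@enum_rank_bij T))) /=; apply: eq_bigr => x _.
  by rewrite mxE mcoeffZ !enum_rankK.
rewrite big1 // => x _; rewrite mcoeffZ memN_msupp_eq0 ?mulr0 //.
by apply: msize_mdeg_ge; apply: leq_trans (sz x) ge_m.
Qed.

Lemma msizeM_pred (p q : P) : (msize (p * q) <= (msize p + msize q).-1)%N.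
Proof.
have [->|p0] := eqVneq p 0; first by rewrite mul0r msize0.
have [->|q0] := eqVneq q 0; first by rewrite mulr0 msize0.
by rewrite msizeM.
Qed.

Lemma msize_exp (a : P) E j : (msize a <= E.+1)%N -> (msize (a ^+ j) <= (j * E).+1)%N.
Proof.
move=> ha; elim: j => [|j IH]; first by rewrite expr0 msize1.
rewrite exprS; apply: leq_trans (msizeM_pred _ _) _.
by move: ha IH; rewrite mulSn; lia.
Qed.

End Independence.

Section RegularSequences.
Variables (k : fieldType).
Notation P := {mpoly k[3]}.

(* For a homogeneous ideal with components P_e/I_e <> 0 in all degrees,
   choosing p_e in P_e outside I for e < T makes the products
   p_e a_0^i0 a_1^i1 a_2^i2 linearly independent for any regular sequence in I;
   the number of those with exponents < T grows like T^4, and the dimension of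
   the space of polynomials of degree O(T) like T^3. *)
Lemma regular_sequence_cofinite (I : P -> Prop) (s : seq P) :
  homogeneous_ideal I -> regular_sequence s -> (forall x, x \in s -> I x) ->
  size s = 3 -> exists e : nat, forall p, ishom e p -> I p.
Proof.
move=> [idI homI] [_ reg] sI sz3.
apply: NNPP => nex.
have out (e : nat) : exists p, ishom e p /\ ~ I p.
  apply: NNPP => H; apply: nex; exists e => p hp; apply: NNPP => nI.
  by apply: H; exists p.
pose E := (\max_(x <- s) msize x)%N.
(* The T^4 products below have size at most T (3E + 1), so independence would give T^4 <= T^3 (3E +
   1)^3; T is chosen just above (3E + 1)^3. *)
pose T := ((3 * E + 1) ^ 3).+1.
have [p Hp] := @fin_all_exists 'I_T _ (fun e p => ishom (e : nat) p /\ ~ I p) (fun e => out e).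
have ind3 : independent_mod (ideal_gen (fun y => y \in take 3 s)) p.
  move=> c /(ideal_gen_sub idI) Ic i; have /homI-/(_ i) : I (\sum_i c i *: p i).
    by apply: Ic => y /mem_take; apply: sI.
  rewrite raddf_sum (bigD1 i) //= big1 => [|j ji]; last first.
    rewrite linearZ /=; have [hj _] := Hp j.
    by rewrite [pihomog _ _ _](hcomp_neq hj (z := i : nat)) ?scaler0 // eqz_nat eq_sym val_eqE.
  have [hi nI] := Hp i; rewrite addr0 linearZ /= [pihomog _ _ _]hi => Icp.
  apply/eqP/negPn/negP => ci; apply: nI.
  have [_ _ IM] := idI; have := IM (c i)^-1%:MP _ Icp.
  by rewrite mul_mpolyC scalerA mulVf // scale1r.
have step i (F : finType) (v : F -> P) : (i < 3)%N ->
    independent_mod (ideal_gen (fun y => y \in take i.+1 s)) v ->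
    independent_mod (ideal_gen (fun y => y \in take i s))
      (fun ij : F * 'I_T => s`_i ^+ ij.2 * v ij.1).
  move=> lti; apply: independent_mod_regular => [x c Hx|x]; last by apply: reg; rewrite sz3.
  have tE : take i.+1 s = rcons (take i s) s`_i by rewrite (take_nth 0) // sz3.
  apply: ideal_genD; last first.
    by rewrite mulrC; apply/ideal_genM/ideal_gen_mem; rewrite tE mem_rcons mem_head.
  move: Hx => [m [b [g [Hg ->]]]]; exists m, b, g; split=> // j.
  by rewrite tE mem_rcons in_cons Hg orbT.
have ind0 := step 0%N _ _ isT (step 1%N _ _ isT (step 2%N _ _ isT ind3)).
have szs i : (i < 3)%N -> (msize s`_i <= E.+1)%N.
  move=> lti; apply: leqW; rewrite /E (big_nth 0) big_mkord.
  have lt' : (i < size s)%N by rewrite sz3.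
  exact: (leq_bigmax (Ordinal lt')).
have := @independent_card _ _ _ _ _ (T * (3 * E + 1))%N (ideal_gen0 _) ind0.
rewrite !card_prod !card_ord => H.
suff : (T * T * T * T <= (T * (3 * E + 1)) ^ 3)%N.
  have -> : (T * T * T * T = T ^ 3 * T)%N by rewrite !expnS expn0 muln1 !mulnA.
  by rewrite expnMn leq_pmul2l ?expn_gt0 // ltnn.
apply: H => [[[[i j0] j1] j2]] /=.
have hi : (msize (p i) <= T)%N.
  have [hi _] := Hp i; rewrite msizeE; apply/bigmax_leqP_seq => m mp _.
  suff -> : mdeg m = i by [].
  apply/eqP; rewrite -eqz_nat; apply: contraTT mp => ne.
  by rewrite mcoeff_msupp negbK; apply/eqP; apply: (proj1 (ishomP _ _) hi).
have h0 := msize_exp j0 (szs 2%N isT); have h1 := msize_exp j1 (szs 1%N isT).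
have h2 := msize_exp j2 (szs 0%N isT).
have l1 := msizeM_pred (s`_2 ^+ j0) (p i).
have l2 := msizeM_pred (s`_1 ^+ j1) (s`_2 ^+ j0 * p i).
have l3 := msizeM_pred (s`_0 ^+ j2) (s`_1 ^+ j1 * (s`_2 ^+ j0 * p i)).
have m0 : (j0 * E <= T * E)%N by rewrite leq_mul2r ltnW ?orbT.
have m1 : (j1 * E <= T * E)%N by rewrite leq_mul2r ltnW ?orbT.
have m2 : (j2 * E <= T * E)%N by rewrite leq_mul2r ltnW ?orbT.
rewrite mulnDr mulnCA muln1; move: l1 l2 l3 hi h0 h1 h2 m0 m1 m2.
do !move: (msize _); move: (j0 * E)%N (j1 * E)%N (j2 * E)%N (T * E)%N.
by clear => *; lia.
Qed.

End RegularSequences.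

(** * Duality on P/I *)

Section Resolutions.
Variables (k : fieldType) (n : nat) (A : comPzRingType).
Variable pi : {rmorphism {mpoly k[n]} -> A}.

Lemma hdegP z x : hdeg pi z x <-> exists p, ishom z p /\ pi p = x.
Proof.
case: z => e /=; split.
- by move=> [p /dhomog_ishom hp <-]; exists p.
- by move=> [p [/dhomog_ishom hp <-]]; exists p.
- by move=> ->; exists 0; split; [exact: ishom0 | rewrite raddf0].
- by move=> [p [<- <-]]; rewrite raddf0.
Qed.

Lemma resolution_lift (F : gcomplex A) J i : minimal_resolution pi F J ->
  exists D, hmx (@gc_shift _ F i.+1) (@gc_shift _ F i) D /\ map_mx pi D = gc_diff F i.
Proof.
move=> [_ hom _ _ _].
have [u v|D HD] := @fin_mx _ _ _ (fun u v p =>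
    ishom (@gc_shift _ F i.+1 u - @gc_shift _ F i v) p /\ pi p = gc_diff F i u v).
  have /= H := hom i (@gc_shift _ F i.+1 u) (delta_mx 0 u).
  have /H/(_ v)/hdegP : forall j, hdeg pi (- @gc_shift _ F i.+1 j + @gc_shift _ F i.+1 u)
      ((delta_mx 0 u : 'rV[A]_(gc_rank F i.+1)) 0 j).
    move=> j; rewrite mxE eqxx /=; apply/hdegP; case: (j =P u) => [->|_].
      by exists 1; rewrite addNr rmorph1 -mpolyC1; split=> //; apply: ishomC.
    by exists 0; rewrite raddf0; split=> //; apply: ishom0.
  by rewrite -rowE mxE addrC.
exists D; split=> [u v|]; first by case: (HD u v).
by apply/matrixP => u v; rewrite mxE; case: (HD u v).
Qed.

End Resolutions.

Section Cofinite.
Variables (k : fieldType) (n : nat) (I : {mpoly k[n]} -> Prop).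
Hypothesis idI : is_ideal I.

Lemma cofinite_up (e e' : nat) p : (forall p, ishom e p -> I p) -> (e <= e')%N ->
  ishom e' p -> I p.
Proof.
move=> He /subnK <-; elim: (e' - e)%N p => [|m IH] p; first exact: He.
rewrite addSn => hp; have p0 : p@_0 = 0.
  by apply/eqP; case: eqP => // /eqP /(ishom_coeff0 hp).
have [v Ev] := coeff0_sum p0; rewrite -hp Ev hcomp_big; apply: ideal_sum => // i _.
rewrite hcompXl; have [_ _ IM] := idI; apply/IM/IH.
have -> : Posz (m + e).+1 - 1 = (m + e)%N by lia.
exact: hcomp_hom.
Qed.


Hypothesis homI : forall e p, I p -> I (hcomp e p).
Variable e0 : nat.
Hypothesis cof : forall p, ishom e0 p -> I p.

Lemma cofinite_high p : (forall m, (mdeg m < e0)%N -> p@_m = 0) -> I p.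
Proof.
move=> H; rewrite (hcomp_sum p); apply: ideal_sum => // e _.
case: (ltnP e e0) => [lt|ge]; last exact: (cofinite_up cof ge (hcomp_hom _ _)).
have -> : hcomp e p = 0; last by case: (idI).
apply/mpolyP => m; rewrite mcoeff_hcomp mcoeff0 eqz_nat.
by case: eqP => // E; apply: H; rewrite E.
Qed.

(** Multiply by variables as long as the product stays outside I. Degree [e0] lies in I, so this
    stops, and it stops at a socle element. *)
Lemma socle_multiple (e : nat) p : ishom e p -> ~ I p ->
  exists (r : {mpoly k[n]}) (e' : nat),
    [/\ ishom e' r, ~ I (r * p) & forall i, I ('X_i * (r * p))].
Proof.
elim: {e}(e0 - e)%N {-2}e (leqnn (e0 - e)) p => [|m IH] e le p hp nI.
  by case: nI; apply: (cofinite_up cof) hp; rewrite -subn_eq0 -leqn0.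
case: (classic (forall i, I ('X_i * p))) => [H|].
  by exists 1, 0%N; rewrite mul1r -mpolyC1; split=> //; apply: ishomC.
move=> /not_all_ex_not [i ni].
have [||r [e' [hr nr Hr]]] := IH e.+1 _ ('X_i * p) _ ni.
- by rewrite subnS; case: (e0 - e)%N le.
- by have := ishomM (ishomX k i) hp; rewrite -(intS e).
exists (r * 'X_i), e'.+1; rewrite -mulrA; split=> //.
by have := ishomM hr (ishomX k i); rewrite addrC -intS.
Qed.

End Cofinite.

Lemma ord_rank0 m (i : 'I_m) : m <> 0%N.
Proof. by case: m i => [[]|]. Qed.

Lemma ord_rank1 m (i j : 'I_m) : m = 1%N -> i = j.
Proof. by move=> E; subst m; rewrite !ord1. Qed.

Section Socle.
Variable k : fieldType.
Notation P := {mpoly k[3]}.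
Variables (I : P -> Prop) (G : gcomplex P) (b : int) (e0 : nat).
Hypotheses (homI : homogeneous_ideal I) (proper : ~ I 1).
Hypothesis cof : forall p, ishom e0 p -> I p.
Hypotheses (G_res : minimal_resolution idfun G I) (b_twist : back_twist G b).

Let idI : is_ideal I := proj1 homI.

Lemma resolution_exact (R : comPzRingType) (pi : P -> R) (F : gcomplex R) J i
    (y : 'rV_(gc_rank F i.+1)) :
  minimal_resolution pi F J ->
  y *m gc_diff F i = 0 <-> exists w : 'rV_(gc_rank F i.+2), w *m gc_diff F i.+1 = y.
Proof. by case=> _ _ _ H _; apply: H. Qed.

Lemma resolution_min i u v : (gc_diff G i u v)@_0 = 0.
Proof.
case: G_res => _ _ _ _ /(_ i u v); apply: (@coeff0_irrelevant _ _ _ idfun).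
  by move=> y; exists y.
by move=> p /= ->; rewrite mcoeff0.
Qed.

Lemma resolution_im q : I q <-> exists x : 'rV_(gc_rank G 1), x *m gc_diff G 0 = const_mx q.
Proof. by case: G_res. Qed.

Lemma scale_const_mx (R : comPzRingType) m m' (c q : R) :
  c *: const_mx q = const_mx (c * q) :> 'M_(m, m').
Proof. by apply/matrixP => u v; rewrite !mxE. Qed.

Notation link := (koszul_link (gc_diff G 2) (gc_diff G 1) (gc_diff G 0)).

Lemma socle_link q : (forall i, I ('X_i * q)) -> exists w, link w (const_mx q).
Proof.
move=> H; apply: koszul_link_ex => [y|y|i]; try exact: resolution_exact G_res.
by rewrite scale_const_mx; apply/resolution_im.
Qed.

Lemma socle_link_coeff0 w q : link w (const_mx q) -> (forall j, (w 0 j)@_0 = 0) -> I q.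
Proof.
move=> L w0; apply/resolution_im; apply: koszul_link_coeff0 L w0.
  by move=> y; apply: resolution_exact G_res.
by move=> y; apply: resolution_exact G_res.
Qed.

(** If G ended before place 3, a socle element outside I would be linked to a vector of length 0. If
    it ended later, the row of the last differential, having no constant term, would be a sum of x_i
    times cycles; lifting these, injectivity of the last map would put its basis vector in the
    irrelevant ideal. *)
Lemma back_twist3 : gc_rank G 3 = 1%N /\ forall u, @gc_shift _ G 3 u = b.
Proof.
have [l [rl sl hl]] := b_twist.
suff l3 : l = 3 by subst l.
have h1 : ishom (0%N : int) (1 : P) by rewrite -mpolyC1; apply: ishomC.
have [r [e' [_ nI soc]]] := socle_multiple idI cof h1 proper.
have [w Lw] := socle_link soc.
apply/eqP; rewrite eqn_leq; apply/andP; split; rewrite leqNgt; apply/negP => lt; last first.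
  apply: nI; apply: (socle_link_coeff0 Lw) => j.
  by case: (ord_rank0 j); apply: hl.
case: l rl sl hl lt => [|[|[|[|l]]]] // rl _ hl _.
have [_ _ _ ex _] := G_res.
pose u := cast_ord (esym rl) ord0.
have [||v0 [v1 [v2 [V0 V1 V2 E]]]] := @ker_coeff0 k _ _ _ _
    (gc_diff G l.+2) _ _ (@ex l.+1) (@ex l)
    (row u (gc_diff G l.+3)).
- by apply/ex; exists (delta_mx 0 u); rewrite -rowE.
- by move=> j; rewrite mxE resolution_min.
have lift (v : 'rV_(gc_rank G l.+3)) : v *m gc_diff G l.+2 = 0 ->
    exists y, y *m gc_diff G l.+3 = v.
  by move=> V; apply/ex.
have [y0 Y0] := lift _ V0; have [y1 Y1] := lift _ V1; have [y2 Y2] := lift _ V2.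
have : (delta_mx 0 u - ('X_i0 *: y0 + 'X_i1 *: y1 + 'X_i2 *: y2)) *m gc_diff G l.+3 = 0.
  by rewrite mulmxBl -rowE E !mulmxDl -!scalemxAl Y0 Y1 Y2 subrr.
move=> /ex [y]; have -> : y = 0.
  by apply/rowP => j; case: (ord_rank0 j); apply: hl.
rewrite mul0mx => /rowP/(_ u); rewrite !mxE !eqxx /= => /(congr1 (mcoeff 0%MM)) /eqP.
rewrite mcoeff0 !(raddfB, raddfD) /= !rmorphM /= !mcoeffX !mnm1_eq0 !mul0r !subr0 ?oppr0 ?addr0.
by rewrite mcoeff1 eqxx eq_sym oner_eq0.
Qed.

(** The link of q may be taken in degree z + 3 of P(-b); outside I its constant term is non-zero, so
    z + 3 = b. *)
Lemma socle_degree z q : ishom z q -> (forall i, I ('X_i * q)) -> ~ I q -> z = b - 3.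
Proof.
move=> hq soc nI; have [w Lw] := socle_link soc.
have lift i := resolution_lift (pi := idfun) i G_res.
have hG i : hmx (@gc_shift _ G i.+1) (@gc_shift _ G i) (gc_diff G i).
  by have [D [hD <-]] := lift i; rewrite map_mx_id.
have := koszul_link_hpart z (hG 2) (hG 1) (hG 0) Lw.
have -> : hpart (fun=> z) (@gc_shift _ G 0) (const_mx q) = const_mx q :> 'M_(1, _).
  by apply/matrixP => u v; have [[_ s0] _ _ _ _] := G_res; rewrite !mxE s0 subr0 hq.
move=> L; apply: NNPP => ne; apply: nI; apply: (socle_link_coeff0 L) => j.
have [_ s3] := back_twist3; rewrite mxE s3; apply/eqP; case: eqP => // /eqP.
move=> /(ishom_coeff0 (hcomp_hom _ _)) E; case: ne.
by apply/eqP; rewrite -subr_eq0 -E; apply/eqP; ring.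
Qed.

(** As G_3 has rank one, some combination of the two linked vectors has constant term 0. *)
Lemma socle_dim1 q q' : (forall i, I ('X_i * q)) -> ~ I q -> (forall i, I ('X_i * q')) ->
  exists c, I (q' - c *: q).
Proof.
move=> soc nI soc'; have [w Lw] := socle_link soc; have [w' Lw'] := socle_link soc'.
have [j wj] : exists j, (w 0 j)@_0 != 0.
  apply: NNPP => H; apply: nI; apply: (socle_link_coeff0 Lw) => j.
  by apply/eqP/negbNE/negP => nz; apply: H; exists j.
pose c := (w' 0 j)@_0 / (w 0 j)@_0; exists c.
have := koszul_linkD Lw' (koszul_linkZ (- c%:MP) Lw).
have -> : const_mx q' + (- c%:MP) *: const_mx q
    = const_mx (q' - c *: q) :> 'rV[P]_(gc_rank G 0).
  by apply/matrixP => u v; rewrite !mxE mulNr mul_mpolyC.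
move=> L; apply: (socle_link_coeff0 L) => j'.
rewrite (ord_rank1 j' j (proj1 back_twist3)) !mxE mulNr mul_mpolyC raddfB /= linearZ /=.
by rewrite mulfVK // subrr.
Qed.

(** [lam] reads the component of degree b - 3 as a multiple, modulo I, of a socle generator. It is
    non-degenerate because every component outside I has a multiple that is a socle element outside
    I. *)
Lemma socle_functional : exists lam : {scalar P},
  [/\ forall p, I p -> lam p = 0,
      forall z p, ishom z p -> lam p != 0 -> z = b - 3
    & forall p, (forall q, lam (p * q) = 0) -> I p].
Proof.
have [_ ID IM] := idI.
have homI' z p : I p -> I (hcomp z p).
  by case: z => e; [apply: (proj2 homI) | case: idI].
have h1 : ishom (0%N : int) (1 : P) by rewrite -mpolyC1; apply: ishomC.
have [r [e1 [hr nr soc]]] := socle_multiple idI cof h1 proper.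
rewrite mulr1 in nr soc; have e1b := socle_degree hr soc nr.
(* All of degree b - 3 is in the socle: otherwise its product with some variable would have a socle
   multiple outside I of degree above b - 3. *)
have val p : exists c, I (hcomp (b - 3) p - c *: r).
  apply: socle_dim1 => // i; apply: NNPP => nI.
  have hX : ishom e1.+1 ('X_i * hcomp (b - 3) p).
    by have := ishomM (ishomX k i) (hcomp_hom (b - 3) p); rewrite -e1b -intS.
  have [r' [e' [hr' nr' soc']]] := socle_multiple idI cof hX nI.
  have := socle_degree (ishomM hr' hX) soc' nr'; rewrite -e1b; lia.
have [lam Hlam] := functional_choice _ val.
have uniq c : I (c *: r) -> c = 0.
  move=> Icr; apply/eqP/negPn/negP => c0; apply: nr.
  by have := IM (c^-1)%:MP _ Icr; rewrite mul_mpolyC scalerA mulVf // scale1r.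
have lin : scalar lam.
  move=> c p q; apply/eqP; rewrite -subr_eq0; apply/eqP/uniq.
  have := Hlam (c *: p + q); rewrite linearP /= => H.
  have H2 := ID _ _ (IM c%:MP _ (Hlam p)) (Hlam q).
  have := ideal_sub idI H2 H; rewrite mul_mpolyC.
  congr I; rewrite scalerBr scalerA !scalerBl scalerDl /=.
  by rewrite /GRing.mul /=; ring.
pose L := GRing.isLinear.Build k P k *%R lam lin.
pose lamL : {scalar P} := HB.pack lam L.
have lam0 p : I p -> lam p = 0.
  move=> Ip; apply: uniq; have := ideal_sub idI (homI' (b - 3) _ Ip) (Hlam p).
  by rewrite opprB addrC subrK.
exists lamL; split=> [//|z p hp|p Hp] /=.
  apply: contra_neq_eq => ne; apply: uniq; have := Hlam p.
  by rewrite (hcomp_neq hp) ?sub0r 1?eq_sym // => /(ideal_opp idI); rewrite opprK.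
apply: NNPP => nI.
have [e ne] : exists e : nat, ~ I (hcomp e p).
  apply: NNPP => H; apply: nI; rewrite (hcomp_sum p); apply: ideal_sum => // e _.
  by apply: NNPP => H'; apply: H; exists e.
have [r' [e' [hr' nr' soc']]] := socle_multiple idI cof (hcomp_hom e p) ne.
have deg := socle_degree (ishomM hr' (hcomp_hom e p)) soc' nr'.
apply: nr'; have := Hlam (p * r'); have /= -> := Hp r'; rewrite scale0r subr0.
rewrite mulrC (hcompMl _ _ hr').
by have -> : b - 3 - e'%:Z = e by rewrite -deg; ring.
Qed.

End Socle.

Section DoubleAnnihilator.
Variable k : fieldType.
Notation P := {mpoly k[3]}.
Variables (I : P -> Prop) (e0 : nat) (lam : {scalar P}).
Hypotheses (homI : homogeneous_ideal I) (cof : forall p, ishom e0 p -> I p).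
Hypothesis lam0 : forall p, I p -> lam p = 0.
Hypothesis lam_nondeg : forall p, (forall q, lam (p * q) = 0) -> I p.

Let idI : is_ideal I := proj1 homI.

(** Linear algebra in P/I, which the monomials of degree < e0 span without having to be a basis.
    [Am] is the Gram matrix of the pairing lam (p q) and the rows of [T] span the multiples of f; it
    suffices that u Am lie in the row space of T Am, by non-degeneracy. *)
Lemma double_annihilator f u :
  (forall h, I (f * h) -> lam (u * h) = 0) -> exists c, I (u - c * f).
Proof.
pose B := #|{: 'X_{1..3 < e0}}|.
pose mono (j : 'I_B) : P := 'X_[enum_val j : 'X_{1..3 < e0}].
pose vec (p : P) : 'rV_B := \row_j p@_(enum_val j : 'X_{1..3 < e0}).
pose poly (x : 'rV_B) : P := \sum_j x 0 j *: mono j.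
have trunc p : I (p - poly (vec p)).
  apply: (cofinite_high idI cof) => m lt_m.
  rewrite raddfB raddf_sum /= (bigD1 (enum_rank (BMultinom lt_m))) //=.
  rewrite big1 => [|j ne].
    by rewrite mxE enum_rankK mcoeffZ mcoeffX enum_rankK eqxx mulr1 addr0 subrr.
  rewrite mcoeffZ mcoeffX; case: eqP => [E|]; rewrite ?mulr0 //.
  case/eqP: ne; apply: enum_val_inj; rewrite enum_rankK; exact/val_inj.
have lamI p q : I (p - q) -> lam p = lam q.
  by move=> /lam0 /eqP; rewrite raddfB subr_eq0 => /eqP.
have Isubl p q c : I (p - q) -> I (p * c - q * c).
  by rewrite -mulrBl => H; apply: ideal_mulr.
have lam_poly p x : lam (p * poly x) = \sum_j x 0 j * lam (p * mono j).
  rewrite mulr_sumr raddf_sum; apply: eq_bigr => j _ /=.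
  by rewrite -scalerAr linearZ.
have nondeg p : (forall j, lam (p * mono j) = 0) -> I p.
  move=> H; apply: lam_nondeg => q.
  rewrite (lamI _ (p * poly (vec q))); last by rewrite -mulrBr; case: idI => _ _; apply.
  by rewrite lam_poly big1 // => j _; rewrite H mulr0.
pose Am : 'M[k]_B := \matrix_(i, j) lam (mono i * mono j).
have mulA x j : (x *m Am) 0 j = lam (poly x * mono j).
  by rewrite mulrC lam_poly mxE; apply: eq_bigr => i _; rewrite !mxE [mono j * _]mulrC.
have vecA p j : (vec p *m Am) 0 j = lam (p * mono j).
  by rewrite mulA; apply/esym/lamI/Isubl.
move=> Hu; pose T : 'M[k]_B := \matrix_i vec (mono i * f).
have : (vec u *m Am <= T *m Am)%MS.
  rewrite submxE; apply/eqP/rowP => l.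
  (* A column of the cokernel is a polynomial h orthogonal to all multiples of f, that is, with f h
     in I. *)
  set N := cokermx _; pose h := poly (\row_j N j l).
  have hE p : (vec p *m Am *m N) 0 l = lam (p * h).
    by rewrite lam_poly mxE; apply: eq_bigr => j _; rewrite vecA !mxE mulrC.
  rewrite hE [RHS]mxE; apply: Hu; apply: nondeg => i.
  have -> : f * h * mono i = mono i * f * h by ring.
  have := congr1 (fun M : 'M_(B, B) => M i l) (mulmx_coker (T *m Am)).
  rewrite -/N [X in _ = X]mxE => <-; rewrite -hE.
  have -> : vec (mono i * f) = row i T by rewrite rowK.
  by rewrite -!row_mul mxE.
case/submxP => c Ec; exists (poly c).
have E0 : I (poly (vec u) - poly (c *m T)).
  apply: nondeg => j; rewrite mulrBl raddfB /= -!mulA Ec mulmxA subrr //.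
have E1 : I (poly (c *m T) - poly c * f).
  have -> : poly (c *m T) - poly c * f
      = - \sum_i c 0 i *: (mono i * f - poly (vec (mono i * f))).
    have -> : poly (c *m T) = \sum_i c 0 i *: poly (vec (mono i * f)).
      rewrite /poly; under [RHS]eq_bigr do rewrite scaler_sumr.
      rewrite exchange_big; apply: eq_bigr => j _; rewrite mxE scaler_suml.
      by apply: eq_bigr => i _; rewrite scalerA !mxE.
    rewrite mulr_suml -sumrB -sumrN; apply: eq_bigr => i _.
    by rewrite scalerBr opprB scalerAl.
  apply: (ideal_opp idI); apply: ideal_sum => // i _.
  by rewrite -mul_mpolyC; case: (idI) => _ _; apply; apply: trunc.
case: (idI) => _ ID _; have := ID _ _ (ID _ _ (trunc u) E0) E1.
by congr I; ring.
Qed.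

End DoubleAnnihilator.

(** * Generators of modules and ideals *)

Lemma row_free_same_shifts (K : fieldType) m m' (t : 'I_m -> int) (t' : 'I_m' -> int)
    (M : 'M[K]_(m, m')) :
  (forall v : 'rV_m, v *m M = 0 -> v = 0) -> (m' <= m)%N ->
  (forall i j, M i j != 0 -> t i = t' j) -> same_shifts t t'.
Proof.
move=> inj le; have free : row_free M.
  rewrite -kermx_eq0; apply/negPn/negP => /rowV0Pn [v /sub_kermxP vM].
  by rewrite (inj _ vM) eqxx.
have mm : m = m'.
  by apply/eqP; rewrite eqn_leq le andbT -(eqP free) rank_leq_col.
by subst m'; apply: unit_same_shifts; rewrite -row_free_unit.
Qed.

Lemma scalar_factor_leq (D : idomainType) m n (f : D) (A : 'M_(m, n)) B :
  f != 0 -> A *m B = f%:M -> (m <= n)%N.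
Proof.
move=> f0 AB; apply: (@mulmx1_min {fraction D} _ _ (map_mx (@tofrac D) A)
  ((tofrac f)^-1 *: map_mx (@tofrac D) B)).
rewrite -scalemxAr -map_mxM AB map_scalar_mx scale_scalar_mx mulVf //.
by rewrite tofrac_eq0.
Qed.

Section ImageIdeal.
Variables (A : comPzRingType) (m : nat) (g : 'cV[A]_m).

Definition col_ideal (x : A) : Prop := exists y : 'rV_m, x = (y *m g) 0 0.

Lemma col_ideal_is_ideal : is_ideal col_ideal.
Proof.
split=> [|x y [a ->] [b ->]|c x [a ->]].
- by exists 0; rewrite mul0mx mxE.
- by exists (a + b); rewrite mulmxDl [RHS]mxE.
- by exists (c *: a); rewrite -scalemxAl [RHS]mxE.
Qed.

Lemma col_ideal_gen j : col_ideal (g j 0).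
Proof. by exists (delta_mx 0 j); rewrite -rowE mxE. Qed.

Lemma col_ideal_sub (Y : A -> Prop) : is_ideal Y -> (forall j, Y (g j 0)) ->
  forall x, col_ideal x -> Y x.
Proof.
move=> idY Yg x [y ->]; rewrite mxE; apply: ideal_sum => // j _.
by case: (idY) => _ _; apply.
Qed.

End ImageIdeal.

Lemma ideal_gen_is_ideal (A : comPzRingType) (X : A -> Prop) : is_ideal (ideal_gen X).
Proof.
by split=> [|x y|c x]; [exact: ideal_gen0 | exact: ideal_genD | exact: ideal_genM].
Qed.

Lemma ideal_gen_seq (A : comPzRingType) m (s : seq A) : size s = m ->
  forall x, ideal_gen (fun y => y \in s) x <-> col_ideal (\col_(j < m) s`_j) x.
Proof.
move=> sz x; split.
  apply: ideal_gen_sub; first exact: col_ideal_is_ideal.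
  move=> y /(nthP 0) [j lt <-]; rewrite sz in lt.
  by have := col_ideal_gen (\col_(j < m) s`_j) (Ordinal lt); rewrite mxE.
apply: col_ideal_sub; first exact: ideal_gen_is_ideal.
by move=> j; rewrite mxE; apply/ideal_gen_mem/mem_nth; rewrite sz.
Qed.

Lemma row_col'_mul (A : comPzRingType) m n (D : 'M[A]_(m.+1, n)) j (x : 'rV_m.+1) :
  x *m D = x 0 j *: row j D + col' j x *m row' j D.
Proof.
apply/rowP => v; rewrite !mxE (bigD1_ord j) //=; congr (_ + _).
by apply: eq_bigr => i _; rewrite !mxE.
Qed.

Section MinimalGenerators.
Variables (k : fieldType) (n : nat).
Notation P := {mpoly k[n]}.

(** A relation with a unit constant term at j makes row j redundant; that row is deleted and the
    induction is on the number of rows. *)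
Lemma minimal_homogeneous_generators s (t : 'I_s -> int) m0 (D0 : 'M[P]_(m0, s)) a0 :
  hmx a0 t D0 -> exists m (D : 'M[P]_(m, s)) a,
    [/\ hmx a t D, forall y : 'rV_s, (exists x, x *m D0 = y) <-> (exists x, x *m D = y)
      & forall x : 'rV_m, x *m D = 0 -> forall j, (x 0 j)@_0 = 0].
Proof.
elim: m0 D0 a0 => [|m IH] D a hD.
  by exists 0%N, D, a; split=> // x _ [].
case: (classic (forall x : 'rV_m.+1, x *m D = 0 -> forall j, (x 0 j)@_0 = 0)) => [H|].
  by exists m.+1, D, a; split.
move=> H; have [x0 H0] := not_all_ex_not _ _ H; have [x0D H1] := imply_to_and _ _ H0.
have [j x0j] := not_all_ex_not _ _ H1.
(* The part of degree a j is taken, so that the j-th coefficient becomes exactly its constant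
   term. *)
pose x := hpart (fun=> a j) a x0.
have xD : x *m D = 0 by rewrite -(hpartMr _ _ hD) x0D hpart0.
pose c := (x0 0 j)@_0.
have xj : x 0 j = c%:MP.
  rewrite mxE subrr (ishom_const (hcomp_hom 0 _) erefl) coeff0_hcomp //.
have c0 : c != 0 by apply/eqP.
clearbody x.
have [|m' [D' [a' [hD' im min]]]] := IH (row' j D) (fun i => a (lift j i)).
  by move=> u v; rewrite mxE; apply: hD.
exists m', D', a'; split=> // y; rewrite -im; split=> [[w <-]|[w <-]].
  exists (col' j (w - (w 0 j * c^-1%:MP) *: x)).
  transitivity ((w - (w 0 j * c^-1%:MP) *: x) *m D); last first.
    by rewrite mulmxBl -scalemxAl xD scaler0 subr0.
  rewrite (row_col'_mul D j (w - _)) !mxE xj -mulrA -mpolyCM mulVf // mpolyC1 mulr1.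
  by rewrite subrr scale0r add0r.
exists (w *m row' j 1%:M); rewrite -mulmxA; congr (_ *m _).
apply/matrixP => u v; rewrite !mxE (bigD1 (lift j u)) //= big1 => [|i ne].
  by rewrite !mxE eqxx mul1r addr0.
by rewrite !mxE eq_sym (negbTE ne) mul0r.
Qed.

End MinimalGenerators.

(** * The resolution over the hypersurface ring *)

(** The rank of F_0 is 1 only propositionally; this turns the first differential into a genuine
    column. *)
Lemma col_of_rank1 (A : comPzRingType) m n (D : 'M[A]_(m, n)) : n = 1%N ->
  exists c : 'cV[A]_m, [/\ forall v u, D v u = c v 0,
    forall (x : 'rV_m) r, x *m D = const_mx r <-> x *m c = const_mx r
    & forall x : 'rV_m, x *m D = 0 <-> x *m c = 0].
Proof. by move=> E; subst n; exists D; split=> // v u; rewrite ord1. Qed.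

Section Data.
Variables (k : fieldType).
Notation P := {mpoly k[3]}.
Notation ev := (map_mx (mcoeff (0%MM : 'X_{1..3}))).
Variables (f : P) (d : nat) (R : comPzRingType) (pi : {rmorphism P -> R}).
Hypotheses (f_neq0 : f != 0) (f_hom : ishom d f) (f0 : f@_0 = 0).
Hypothesis pi_surj : forall y, exists p, pi p = y.
Hypothesis pi_ker : forall p, pi p = 0 <-> exists c, p = c * f.
Variable I : P -> Prop.
Hypothesis homI : homogeneous_ideal I.
Variable F : gcomplex R.
Hypothesis F_res : minimal_resolution pi F (extended_ideal pi I).

Let idI : is_ideal I := proj1 homI.
Notation J := (extended_ideal pi I).
Notation r i := (gc_rank F i).
Notation t i := (@gc_shift _ F i).

(** * Lifting the presentation of J to P *)

Lemma extended_ideal_lift y : J y <-> exists p, I p /\ pi p = y.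
Proof.
split=> [|[p [Ip <-]]]; last by apply: ideal_gen_mem; exists p.
apply: (ideal_gen_sub (Y := fun y => exists p, I p /\ pi p = y)) => [|z [p Ip <-]];
  last by exists p.
have [I0 ID IM] := idI; split.
- by exists 0; rewrite raddf0.
- by move=> _ _ [p [Ip <-]] [q [Iq <-]]; exists (p + q); rewrite raddfD; split=> //; apply: ID.
- move=> c _ [p [Ip <-]]; have [c' <-] := pi_surj c; exists (c' * p).
  by rewrite rmorphM; split=> //; apply: IM.
Qed.

Lemma extended_idealP p : J (pi p) <-> exists c, I (p - c * f).
Proof.
rewrite extended_ideal_lift; split=> [[q [Iq E]]|[c H]].
  have /pi_ker [c Ec] : pi (p - q) = 0 by rewrite raddfB /= E subrr.
  by exists c; rewrite -Ec opprB addrC subrK.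
exists (p - c * f); split=> //; rewrite raddfB /=.
by have -> : pi (c * f) = 0; [apply/pi_ker; exists c | rewrite subr0].
Qed.

Lemma kernel_irr i (x : 'rV_(r i.+1)) : x *m gc_diff F i = 0 ->
  forall j, irrelevant_ideal pi (x 0 j).
Proof.
have [_ _ _ ex min] := F_res; move=> /ex [y <-] j; rewrite mxE.
apply: (ideal_sum (I := irrelevant_ideal pi)); first exact: ideal_gen_is_ideal.
by move=> l _; apply: ideal_genM; apply: min.
Qed.

Lemma kernel_coeff0 i (x : 'rV_(r i.+1)) : x *m gc_diff F i = 0 ->
  forall y, map_mx pi y = x -> forall j, (y 0 j)@_0 = 0.
Proof.
move=> x0 y Ey j; apply: (coeff0_irr f0 pi_surj pi_ker).
by have := kernel_irr x0 j; rewrite -Ey mxE.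
Qed.

(** The lifts are chosen in I itself and not merely in (I, f): passing to a homogeneous component of
    a lift in I changes it modulo f only by a multiple of f. *)
Lemma first_generators : exists g : 'cV[P]_(r 1),
  [/\ hmx (t 1) (fun=> 0) g, forall v, I (g v 0),
      forall p, J (pi p) <-> exists x : 'rV_(r 1), x *m map_mx pi g = const_mx (pi p)
    & forall x : 'rV_(r 1), x *m map_mx pi g = 0 <-> x *m gc_diff F 0 = 0].
Proof.
have [[r0 s0] _ im _ _] := F_res.
have [c [Dc imc kerc]] := col_of_rank1 (gc_diff F 0) r0.
have [D [hD ED]] := resolution_lift 0 F_res.
pose u0 := cast_ord (esym r0) ord0.
have piD v : pi (D v u0) = c v 0 by rewrite -(Dc v u0) -ED mxE.
have [v w|g Hg] := @fin_mx _ (r 1) 1 (fun v w p => [/\ ishom (t 1 v) p, I p & pi p = c v w]).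
  rewrite ord1 -piD.
  have /extended_ideal_lift [q [Iq Eq]] : J (pi (D v u0)).
    by apply/im; exists (delta_mx 0 v); apply/rowP => j; rewrite -rowE !mxE piD.
  have hDv := hD v u0; rewrite s0 subr0 in hDv.
  have /pi_ker [e Ee] : pi (D v u0 - q) = 0 by rewrite raddfB /= Eq subrr.
  exists (hcomp (t 1 v) q); split; first exact: hcomp_hom.
    by case: (t 1 v) => m; [apply: (proj2 homI) | case: (idI)].
  apply/eqP; rewrite eq_sym -subr_eq0 -raddfB -[D v u0]hDv -raddfB /= Ee mulrC.
  rewrite (hcompMl _ _ f_hom).
  by apply/eqP/pi_ker; eexists; rewrite mulrC.
have gc : map_mx pi g = c by apply/matrixP => v w; rewrite mxE; case: (Hg v w).
exists g; split=> [v w|v|p|x].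
- by rewrite subr0; case: (Hg v w).
- by case: (Hg v 0).
- by rewrite gc im; split=> [[x /imc]|[x /imc]]; exists x.
- by rewrite gc kerc.
Qed.

Variable g : 'cV[P]_(r 1).
Hypotheses (g_hom : hmx (t 1) (fun=> 0) g) (gI : forall v, I (g v 0)).
Hypothesis g_im : forall p,
  J (pi p) <-> exists x : 'rV_(r 1), x *m map_mx pi g = const_mx (pi p).
Hypothesis g_ker : forall x : 'rV_(r 1), x *m map_mx pi g = 0 <-> x *m gc_diff F 0 = 0.

Lemma first_kernel_coeff0 m (X : 'M[P]_(m, r 1)) : map_mx pi (X *m g) = 0 -> ev X = 0.
Proof.
move=> X0; apply/matrixP => u v; rewrite !mxE.
have E : map_mx pi (row u X) *m gc_diff F 0 = 0.
  by apply/g_ker; rewrite -map_mxM -row_mul map_row X0 row0.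
by have := kernel_coeff0 E erefl v; rewrite mxE.
Qed.

Lemma graded_nakayama :
  (forall p, I p -> exists (y : 'rV_(r 1)) (q : 'I_3 -> P),
     p = (y *m g) 0 0 + \sum_i 'X_i * q i /\ forall i, I (q i)) ->
  forall p, I p -> col_ideal g p.
Proof.
move=> dec p Ip; have idg := col_ideal_is_ideal g.
rewrite (hcomp_sum p); apply: ideal_sum => // e _; move: (nat_of_ord e) => {}e.
elim: e p Ip => [|e IH] p /dec [y [q [-> Iq]]]; rewrite hcompD.
  rewrite hcomp_big big1 => [|i _]; last by rewrite hcompXl mulr0.
  rewrite addr0; exists (hpart (fun=> 0) (t 1) y).
  by rewrite -(hpartMr _ _ g_hom) [RHS]mxE subr0.
have [_ gD gM] := idg; apply: gD.
  exists (hpart (fun=> Posz e.+1) (t 1) y).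
  by rewrite -(hpartMr _ _ g_hom) [RHS]mxE subr0.
rewrite hcomp_big; apply: ideal_sum => // i _; rewrite hcompXl; apply: gM.
have -> : Posz e.+1 - 1 = e by lia.
exact: IH.
Qed.

(** Let H be m generators of I, so that g = A H and H = B g modulo f. Minimality of F gives A B = 1
    on constant terms, whence r 1 <= m; minimality for J gives m <= r 1. So B A = 1 on constant
    terms too, hence I is (g) plus the irrelevant ideal times I. *)
Lemma first_generators_lift :
  (exists m, min_number_of_generators I m /\ min_number_of_generators J m) ->
  forall p, I p <-> col_ideal g p.
Proof.
move=> [m [[[h sz_h gen_h] _] [_ minJ]]] p.
split; last by apply: col_ideal_sub.
pose H := \col_(j < m) h`_j.
have IH x : I x <-> col_ideal H x by rewrite gen_h (ideal_gen_seq sz_h).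
have le_m : (m <= r 1)%N.
  have <- : size [seq pi (g v 0) | v <- enum 'I_(r 1)] = r 1 by rewrite size_map size_enum_ord.
  apply: minJ => y; have [y' <-] := pi_surj y; rewrite g_im; split=> [[x]|].
    move=> /(congr1 (fun M : 'rV_1 => M 0 0)); rewrite [RHS]mxE => <-; rewrite mxE.
    apply: ideal_sum => [|j _]; first exact: ideal_gen_is_ideal.
    by apply/ideal_genM/ideal_gen_mem; rewrite mxE; apply/map_f; rewrite mem_enum.
  rewrite -g_im; apply: ideal_gen_sub; first exact: ideal_gen_is_ideal.
  move=> z /mapP [v _ ->]; apply/extended_ideal_lift.
  by exists (g v 0).
have [A EA] : exists A, A *m H = g.
  apply: rows_mx => u; have /IH [x Ex] := gI u; exists x.
  by apply/rowP => j; rewrite ord1 -Ex mxE.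
have [B EB] : exists B, map_mx pi (B *m g) = map_mx pi H.
  have [|B0 EB0] := @rows_mx _ _ _ _ (map_mx pi g) (map_mx pi H).
    move=> u; have /g_im [x Ex] : J (pi (H u 0)).
      apply/extended_ideal_lift; exists (H u 0); split=> //; apply/IH; exact: col_ideal_gen.
    by exists x; rewrite Ex; apply/rowP => j; rewrite ord1 !mxE.
  by have [B HB] := pi_lift_mx pi_surj B0; exists B; rewrite map_mxM HB.
have AB : ev A *m ev B = 1%:M.
  apply/eqP; rewrite -subr_eq0 -(map_mx1 (mcoeff (0%MM : 'X_{1..3}))) -map_mxM -map_mxB.
  apply/eqP/first_kernel_coeff0.
  by rewrite mulmxBl mul1mx -mulmxA map_mxB map_mxM EB -map_mxM EA subrr.
have mr : m = r 1 by apply/eqP; rewrite eqn_leq le_m (mulmx1_min AB).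
have BA : ev B *m ev A = 1%:M.
  by move: (A) (B) AB; rewrite -mr => A' B' /mulmx1C.
apply: graded_nakayama => q /IH [y Ey].
pose C := y *m (1%:M - B *m A).
have C0 j : (C 0 j)@_0 = 0.
  have : ev C = 0 by rewrite map_mxM map_mxB map_mx1 map_mxM BA subrr mulmx0.
  by move=> /rowP/(_ j); rewrite !mxE.
have [v0 [v1 [v2 EC]]] := coeff0_sum_row C0.
pose v (i : 'I_3) := if i == i0 then v0 else if i == i1 then v1 else v2.
exists (y *m B), (fun i => (v i *m H) 0 0); split; last first.
  by move=> i; apply/IH; exists (v i).
have -> : q = (y *m B *m g) 0 0 + (C *m H) 0 0.
  rewrite Ey /C -EA; have -> : y *m H = y *m B *m (A *m H) + y *m (1%:M - B *m A) *m H.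
    by rewrite -!mulmxA -mulmxDr mulmxBl mul1mx -mulmxA addrC subrK.
  by rewrite mxE.
congr (_ + _); have -> : (C *m H) 0 0
    = 'X_i0 * (v0 *m H) 0 0 + 'X_i1 * (v1 *m H) 0 0 + 'X_i2 * (v2 *m H) 0 0.
  rewrite EC !mulmxDl -!scalemxAl; move: (v0 *m H) (v1 *m H) (v2 *m H) => a b c.
  by rewrite !mxE.
rewrite sum3 /v !eqxx.
have -> : (i1 == i0) = false by rewrite -val_eqE /= !inordK.
have -> : (i2 == i0) = false by rewrite -val_eqE /= !inordK.
by have -> : (i2 == i1) = false by rewrite -val_eqE /= !inordK.
Qed.

Hypothesis I_gen : forall p, I p <-> col_ideal g p.

Lemma hmx_divf m m' (a : 'I_m -> int) (a' : 'I_m' -> int) (C : 'M[P]_(m, m')) :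
  hmx a a' (f *: C) -> hmx (fun u => a u - d%:Z) a' C.
Proof.
move=> H; have := hpart_id H; rewrite (hpartZf f_hom) => /(fZI f_neq0) <-.
exact: hpart_hmx.
Qed.

Lemma second_syzygies : exists (Phi : 'M[P]_(r 2, r 1)) (h : 'cV[P]_(r 2)),
  [/\ hmx (t 2) (t 1) Phi, map_mx pi Phi = gc_diff F 1, Phi *m g = f *: h
    & hmx (fun u => t 2 u - d%:Z) (fun=> 0) h].
Proof.
have [Phi [hPhi EPhi]] := resolution_lift 1 F_res.
have [_ _ _ ex _] := F_res.
have /(pi_ker_mx pi_ker) [h Eh] : map_mx pi (Phi *m g) = 0.
  rewrite map_mxM EPhi; apply/row_matrixP => u; rewrite row_mul row0; apply/g_ker/ex.
  by exists (delta_mx 0 u); rewrite -rowE.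
exists Phi, h; split=> //; apply: hmx_divf; rewrite -Eh; exact: hmxM hPhi g_hom.
Qed.

Variables (Phi : 'M[P]_(r 2, r 1)) (h : 'cV[P]_(r 2)).
Hypotheses (hPhi : hmx (t 2) (t 1) Phi) (EPhi : map_mx pi Phi = gc_diff F 1).
Hypotheses (Phi_g : Phi *m g = f *: h) (hh : hmx (fun u => t 2 u - d%:Z) (fun=> 0) h).

Lemma kernel1 m (Y : 'M[P]_(m, r 1)) : map_mx pi (Y *m g) = 0 ->
  exists Z C, Y = Z *m Phi + f *: C.
Proof.
move=> Y0; have [_ _ _ ex _] := F_res.
have [u|Z0 HZ0] := @rows_mx _ _ _ _ (gc_diff F 1) (map_mx pi Y).
  by apply/ex/g_ker; rewrite -row_mul -map_mxM Y0 row0.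
have [Z HZ] := pi_lift_mx pi_surj Z0; exists Z.
have /(pi_ker_mx pi_ker) [C HC] : map_mx pi (Y - Z *m Phi) = 0.
  by rewrite map_mxB map_mxM HZ EPhi HZ0 subrr.
by exists C; rewrite -HC addrC subrK.
Qed.

(** From f q = y g, the row y is a syzygy of g modulo f, so y = z Phi + f C; cancelling f in f q = f
    z h + f C g leaves q. *)
Lemma colon_generators q : I (f * q) -> exists (y : 'rV_(r 2)) i, I i /\ q = (y *m h) 0 0 + i.
Proof.
move=> /I_gen [y Ey].
have /kernel1 [z [C EY]] : map_mx pi (y *m g) = 0.
  apply/matrixP => u v; rewrite !ord1 mxE -Ey mxE; apply/pi_ker.
  by exists q; rewrite mulrC.
exists z, ((C *m g) 0 0); split; first by apply/I_gen; exists C.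
apply: (mulfI f_neq0); rewrite Ey EY mulmxDl -mulmxA Phi_g -scalemxAr -scalemxAl -scalerDr.
by rewrite [LHS]mxE; congr (_ * _); rewrite [LHS]mxE.
Qed.

Lemma colon_mem v : I (f * h v 0).
Proof.
have -> : f * h v 0 = (row v Phi *m g) 0 0 by rewrite -row_mul Phi_g !mxE.
by apply/I_gen; exists (row v Phi).
Qed.

Lemma socle_lifts s (sigma : 'I_s -> int) : socle_degrees pi J sigma ->
  exists U : 'I_s -> P,
    [/\ forall i, ishom (sigma i) (U i),
        forall i j, exists c, I ('X_j * U i - c * f)
      & forall v : 'I_s -> k, (exists c, I (\sum_i v i *: U i - c * f)) ->
          forall i, v i = 0].
Proof.
move=> [u [soc indep _]].
have [i|U HU] := @fin_all_exists _ _ (fun i p => ishom (sigma i) p /\ pi p = u i).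
  by apply/hdegP; case: (soc i).
exists U; split=> [i|i j|v].
- by case: (HU i).
- apply/extended_idealP; rewrite rmorphM mulrC /=; have [_ ->] := HU i.
  by apply: (proj2 (soc i)); apply: ideal_gen_mem; exists j.
- move=> /extended_idealP Jv; apply: indep; move: Jv; rewrite raddf_sum /=.
  by congr (J _); apply: eq_bigr => i _; rewrite -mul_mpolyC rmorphM; case: (HU i) => _ ->.
Qed.

(** * Socle pairing and the shifts of the second module *)

Variables (s : nat) (sigma : 'I_s -> int) (U : 'I_s -> P).
Hypothesis U_hom : forall i, ishom (sigma i) (U i).
Hypothesis U_soc : forall i j, exists c, I ('X_j * U i - c * f).
Hypothesis U_indep : forall v : 'I_s -> k,
  (exists c, I (\sum_i v i *: U i - c * f)) -> forall i, v i = 0.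

(** If v M = 0, the socle element u with coordinates v is orthogonal to every h_j, hence to all of
    (I : f), so u lies in (I, f) and v = 0. A non-zero entry of M forces sigma_i + t 2 j - d = b -
    3. *)
Lemma second_shifts (lam : {scalar P}) (e0 : nat) (b : int) :
  (forall p, ishom e0 p -> I p) -> (forall p, I p -> lam p = 0) ->
  (forall z p, ishom z p -> lam p != 0 -> z = b - 3) ->
  (forall p, (forall q, lam (p * q) = 0) -> I p) -> (r 2 <= s)%N ->
  same_shifts (t 2) (fun i => b + a_invariant d - sigma i).
Proof.
move=> cof lam0 lam_deg lam_nondeg le_s; have [_ ID IM] := idI.
pose M := \matrix_(i < s, j < r 2) lam (U i * h j 0).
suff [w [bw Hw]] : same_shifts (fun i => sigma i) (fun j => b - 3 + d - t 2 j).
  apply: same_shifts_sym; exists w; split=> // i; rewrite Hw /a_invariant; ring.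
apply: (row_free_same_shifts (M := M)) => // [v vM|i j]; last first.
  rewrite mxE => /(lam_deg (sigma i + (t 2 j - d%:Z))) <-; first by ring.
  by apply: ishomM => //; have := hh j 0; rewrite subr0.
apply/rowP => i; rewrite mxE; move: i; apply: U_indep.
set u := \sum_i _.
have uh j : lam (u * h j 0) = 0.
  move/rowP: vM => /(_ j); rewrite !mxE => <-.
  rewrite mulr_suml raddf_sum; apply: eq_bigr => i _ /=.
  by rewrite -scalerAl linearZ mxE.
have Xuh l j : I ('X_l * u * h j 0).
  rewrite mulr_sumr mulr_suml; apply: ideal_sum => // i _.
  have [c Hc] := U_soc i l; rewrite -scalerAr -scalerAl -mul_mpolyC; apply: (IM).
  have -> : 'X_l * U i * h j 0 = h j 0 * ('X_l * U i - c * f) + c * (f * h j 0) by ring.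
  by apply: (ID); apply: (IM) => //; apply: colon_mem.
apply: (double_annihilator homI cof lam0 lam_nondeg) => q /colon_generators [y [i [Ii ->]]].
have lamI p p' : I p' -> lam (p + p') = lam p by move=> /lam0 E; rewrite raddfD /= E addr0.
rewrite mulrDr lamI; last exact: IM.
rewrite mxE mulr_sumr raddf_sum big1 //= => j _.
(* Since variables times u h_j lie in I, only the constant terms of the coefficients of the h_j
   matter. *)
have y0 : (y 0 j - ((y 0 j)@_0)%:MP)@_0 = 0 by rewrite mcoeffB mcoeffC eqxx mulr1 subrr.
have [w Ew] := coeff0_sum y0; rewrite -[y 0 j](subrK ((y 0 j)@_0)%:MP) Ew.
have -> : u * ((\sum_i0 'X_i0 * w i0 + ((y 0 j)@_0)%:MP) * h j 0)
    = (y 0 j)@_0 *: (u * h j 0) + \sum_l w l * ('X_l * u * h j 0).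
  rewrite -mul_mpolyC mulrDl mulrDr addrC; congr (_ + _); first by ring.
  by rewrite mulr_suml mulr_sumr; apply: eq_bigr => l _; ring.
rewrite lamI; first by rewrite linearZ /= uh mulr0.
by apply: ideal_sum => // l _; apply: IM.
Qed.

(* The syzygies over P of the rows of [gc_diff F 1], a third syzygy module of
   P/(I, f). *)
Definition lifted_syzygy (y : 'rV[P]_(r 2)) : Prop := exists C, y *m Phi = f *: C.

(** Lifting the third differential gives generators only modulo f; the rows of [f%:M] supply the
    rest. *)
Lemma lifted_syzygy_gens : exists m0 (D0 : 'M[P]_(m0, r 2)) a0, hmx a0 (t 2) D0 /\
  forall y, lifted_syzygy y <-> exists x, x *m D0 = y.
Proof.
have [rho [hrho Erho]] := resolution_lift 2 F_res.
pose a0 (i : 'I_(r 3 + r 2)) := match split i with inl u => t 3 u | inr v => t 2 v + d%:Z end.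
exists (r 3 + r 2)%N, (col_mx rho f%:M), a0; split.
  move=> i v; rewrite /a0 mxE; case: (split i) => u; first exact: hrho.
  rewrite mxE; case: (u =P v) => [->|_]; last exact: ishom0.
  by have -> : t 2 v + d - t 2 v = d by ring.
have [_ _ _ ex _] := F_res.
move=> y; split=> [[C HC]|[x <-]].
  have /ex [z Ez] : map_mx pi y *m gc_diff F 1 = 0.
    by rewrite -EPhi -map_mxM HC; apply/(pi_ker_mx pi_ker); exists C.
  have [z' Ez'] := pi_lift_mx pi_surj z.
  have /(pi_ker_mx pi_ker) [w Ew] : map_mx pi (y - z' *m rho) = 0.
    by rewrite map_mxB map_mxM Ez' Erho Ez subrr.
  exists (row_mx z' w); rewrite mul_row_col mul_mx_scalar -Ew addrC subrK //.
apply/(pi_ker_mx pi_ker); rewrite -[x]hsubmxK mul_row_col mulmxDl mul_mx_scalar map_mxD.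
have -> : map_mx pi (lsubmx x *m rho *m Phi) = 0.
  by rewrite !map_mxM Erho EPhi; apply/ex; exists (map_mx pi (lsubmx x)).
by rewrite add0r -scalemxAl; apply/(pi_ker_mx pi_ker); eexists.
Qed.

(** * The resolution of P/(I, f) of length three *)

Variables (m : nat) (D : 'M[P]_(m, r 2)) (a : 'I_m -> int).
Hypothesis D_hom : hmx a (t 2) D.
Hypothesis D_im : forall y, lifted_syzygy y <-> exists x, x *m D = y.
Hypothesis D_min : forall x : 'rV_m, x *m D = 0 -> forall j, (x 0 j)@_0 = 0.

Lemma D_Phi : exists C : 'M_(m, r 1), hmx (fun u => a u - d%:Z) (t 1) C /\ D *m Phi = f *: C.
Proof.
have [u|C HC] := @rows_mx _ _ _ _ (f%:M : 'M_(r 1)) (D *m Phi).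
  have /D_im [c Hc] : exists x, x *m D = row u D by exists (delta_mx 0 u); rewrite -rowE.
  by exists c; rewrite row_mul Hc mul_mx_scalar.
exists C; rewrite -HC mul_mx_scalar; split=> //; apply: hmx_divf.
by rewrite -mul_mx_scalar HC; apply: hmxM D_hom hPhi.
Qed.

Variable C : 'M[P]_(m, r 1).
Hypotheses (C_hom : hmx (fun u => a u - d%:Z) (t 1) C) (DPhi : D *m Phi = f *: C).

(** [res1] lists the generators g and f of (I, f). The rows of [res2] are the relations Phi g - f h
    = 0 and the Koszul relations f g - g f = 0. [res3] pairs the generators of the lifted syzygies
    with the cofactor in D Phi = f C. *)
Definition res3 : 'M[P]_(m, r 2 + r 1) := row_mx D (- C).
Definition res2 : 'M[P]_(r 2 + r 1, r 1 + 1) := block_mx Phi (- h) f%:M (- g).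
Definition res1 : 'M[P]_(r 1 + 1, 1) := col_mx g f%:M.

Lemma mul_res2 (x : 'rV_(r 2)) (y : 'rV_(r 1)) :
  row_mx x y *m res2 = row_mx (x *m Phi + f *: y) (- (x *m h + y *m g)).
Proof. by rewrite mul_row_block mul_mx_scalar !mulmxN opprD. Qed.

Lemma mul_res1 (x : 'rV_(r 1)) (y : 'rV_1) : row_mx x y *m res1 = x *m g + f *: y.
Proof. by rewrite mul_row_col mul_mx_scalar. Qed.

Lemma exact_res1 (x : 'rV_(r 1 + 1)) : x *m res1 = 0 <-> exists w, w *m res2 = x.
Proof.
rewrite -[x]hsubmxK mul_res1; move: (lsubmx x) (rsubmx x) => {}x y; split.
  move=> E; have [|z [w Ew]] := @kernel1 _ x.
    by apply/(pi_ker_mx pi_ker); exists (- y); apply/eqP; rewrite scalerN -subr_eq0 opprK E.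
  exists (row_mx z w); rewrite mul_res2 -Ew; congr row_mx; apply: (fZI f_neq0).
  apply/eqP; rewrite scalerN eq_sym -addr_eq0 addrC -E Ew mulmxDl -mulmxA Phi_g.
  by rewrite scalerDr -scalemxAr -scalemxAl.
move=> [w]; rewrite -[w]hsubmxK mul_res2 => /eq_row_mx [<- <-].
by rewrite mulmxDl -mulmxA Phi_g -scalemxAr -scalemxAl scalerN scalerDr subrr.
Qed.

(** The first block column decides: it makes x a lifted syzygy and determines y. The second then
    vanishes because D h = C g, by cancelling f. *)
Lemma exact_res2 (x : 'rV_(r 2 + r 1)) : x *m res2 = 0 <-> exists w, w *m res3 = x.
Proof.
rewrite -[x]hsubmxK mul_res2; move: (lsubmx x) (rsubmx x) => {}x y; split.
  rewrite -[0 in X in X -> _]hsubmxK => /eq_row_mx [E _].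
  rewrite linear0 in E.
  have /D_im [w Ew] : lifted_syzygy x.
    by exists (- y); apply/eqP; rewrite scalerN -addr_eq0 E.
  exists w; rewrite mul_mx_row Ew; congr row_mx; apply: (fZI f_neq0).
  rewrite mulmxN scalerN scalemxAr -DPhi mulmxA Ew.
  by apply/eqP; rewrite eq_sym -addr_eq0 addrC E.
move=> [w]; rewrite mul_mx_row => /eq_row_mx [<- <-].
have E : f *: (D *m h - C *m g) = 0.
  by rewrite scalerBr (scalemxAr f D h) -Phi_g (scalemxAl f C g) -DPhi mulmxA subrr.
have -> : w *m D *m h + w *m - C *m g = w *m (D *m h - C *m g).
  by rewrite mulmxN mulmxBr !mulmxA mulNmx.
have -> : D *m h - C *m g = 0 by apply: (fZI f_neq0); rewrite E scaler0.
by rewrite -mulmxA DPhi mulmxN -scalemxAr scalerN subrr mulmx0 oppr0 row_mx0.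
Qed.

Lemma ker_res3 (w : 'rV_m) : w *m res3 = 0 <-> w *m D = 0.
Proof.
rewrite mul_mx_row -[0 in X in X <-> _]hsubmxK; split=> [/eq_row_mx [-> _]|E].
  by rewrite linear0.
congr row_mx; rewrite linear0 //; apply: (fZI f_neq0).
by rewrite mulmxN scalerN scalemxAr -DPhi mulmxA E mul0mx oppr0 scaler0.
Qed.

(** A kernel element has no constant terms, so it is a sum of x_i v_i with v_i in the kernel;
    induction on the degree kills all its components. This is the freeness of the third syzygy
    module. *)
Lemma D_inj n0 (w : 'M_(n0, m)) : w *m D = 0 -> w = 0.
Proof.
suff inj (x : 'rV_m) : x *m D = 0 -> x = 0.
  by move=> E; apply/row_matrixP => u; rewrite row0; apply: inj; rewrite -row_mul E row0.
move=> xD; apply/rowP => j; rewrite mxE; apply: hcomp_eq0 => e.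
have [N ltN] : exists N, (e < N)%N by exists e.+1.
elim: N x xD j e ltN => [|N IH] x xD j e // ltN.
have [||v0 [v1 [v2 [V0 V1 V2 ->]]]] := @ker_coeff0 k _ _ _ _ res3 res2 res1
  exact_res2 exact_res1 x.
- exact/ker_res3.
- exact: D_min.
have comp (v : 'rV_m) i : v *m res3 = 0 -> hcomp e ('X_i * v 0 j) = 0.
  move=> /ker_res3 vD; rewrite hcompXl; case: e ltN => [|e] ltN.
    by rewrite mulr0.
  have -> : Posz e.+1 - 1 = e by lia.
  by rewrite IH // mulr0.
by rewrite !mxE !hcompD !comp // !addr0.
Qed.

Lemma hmx_scalar_f n0 (b : 'I_n0 -> int) : hmx (fun v => b v + d%:Z) b (f%:M : 'M[P]_n0).
Proof.
move=> u v; rewrite mxE; case: (u =P v) => [->|_]; last exact: ishom0.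
by have -> : b v + d - b v = d by ring.
Qed.

(** Multiples of f are lifted syzygies, whence Psi D = f; the product in the other order follows by
    cancelling D. *)
Lemma cofactor : exists Psi : 'M_(r 2, m),
  [/\ hmx (fun v => t 2 v + d%:Z) a Psi, D *m Psi = f%:M & Psi *m D = f%:M].
Proof.
have [u|Psi0 HPsi0] := @rows_mx _ _ _ _ D (f%:M : 'M_(r 2)).
  by apply/D_im; exists (row u Phi); rewrite -row_mul mul_scalar_mx linearZ.
pose Psi := hpart (fun v => t 2 v + d%:Z) a Psi0; exists Psi.
have PsiD : Psi *m D = f%:M.
  by rewrite -(hpartMr _ _ D_hom) HPsi0 hpart_id //; apply: hmx_scalar_f.
split=> //; first exact: hpart_hmx.
apply/eqP; rewrite -subr_eq0; apply/eqP/D_inj.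
by rewrite mulmxBl -mulmxA PsiD mul_mx_scalar mul_scalar_mx subrr.
Qed.

(** The socle basis is linked to s vectors whose constant terms are independent, and D Psi = f gives
    m <= r 2 = s, so the matrix [W] is square. The 3 comes from the Koszul complex. *)
Lemma D_shifts : r 2 = s -> same_shifts (fun i => sigma i + 3) a.
Proof.
move=> r2s; have [Psi [_ DPsi _]] := cofactor.
pose s2 (i : 'I_(r 2 + r 1)) := match split i with inl u => t 2 u | inr v => t 1 v + d%:Z end.
pose s1 (i : 'I_(r 1 + 1)) := match split i with inl u => t 1 u | inr v => d%:Z end.
have h3 : hmx a s2 res3.
  move=> u i; rewrite /s2 mxE; case: (split i) => v; first exact: D_hom.
  by rewrite mxE; apply: ishomN; have := C_hom u v; rewrite opprD addrA addrAC.
have h2 : hmx s2 s1 res2.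
  move=> i j; rewrite /s2 /s1 mxE; case: (split i) => u; rewrite mxE; case: (split j) => v.
  - exact: hPhi.
  - by rewrite mxE; apply: ishomN; have := hh u v; rewrite subr0.
  - exact: hmx_scalar_f.
  - by rewrite mxE addrK; apply: ishomN; have := g_hom u v; rewrite subr0.
have h1 : hmx s1 (fun=> 0) res1.
  move=> i j; rewrite /s1 mxE; case: (split i) => u; first exact: g_hom.
  by rewrite !ord1 mxE eqxx subr0.
have [i|w Hw] := @fin_all_exists 'I_s _ (fun i (w : 'rV_m) =>
    koszul_link res3 res2 res1 w (const_mx (U i)) /\
    forall j, ishom (sigma i + 3 - a j) (w 0 j)).
  have [l|w Lw] := koszul_link_ex exact_res2 exact_res1 (p := const_mx (U i)).
    have [c /I_gen [y Ey]] := U_soc i l; exists (row_mx y c%:M).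
    have fc : (f *: (c%:M : 'M_1)) 0 0 = c * f by rewrite !mxE eqxx mulr1n mulrC.
    rewrite mul_res1 scale_const_mx; apply/rowP => j.
    by rewrite !ord1 [RHS]mxE [LHS]mxE fc -Ey subrK.
  exists (hpart (fun=> sigma i + 3) a w); split; last by move=> j; apply: hpart_hmx.
  have := koszul_link_hpart (sigma i) h3 h2 h1 Lw.
  congr (koszul_link _ _ _ _ _); apply/rowP => j.
  by rewrite !mxE subr0; apply: U_hom.
pose W := \matrix_(i, j) (w i 0 j)@_0.
apply: (row_free_same_shifts (M := W)) => [v vW||i j]; last first.
- by rewrite mxE => /(ishom_coeff0 (proj2 (Hw i) j)) /eqP; rewrite subr_eq0 => /eqP.
- by rewrite -r2s; apply: scalar_factor_leq f_neq0 DPsi.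
have := koszul_link_comb (fun i => (v 0 i)%:MP) (fun i => proj1 (Hw i)).
move=> L; have [j|z] := koszul_link_coeff0 exact_res2 exact_res1 L.
  move/rowP: vW => /(_ j); rewrite !mxE => <-; rewrite summxE raddf_sum.
  by apply: eq_bigr => i _; rewrite !mxE /= rmorphM /= mcoeffC eqxx mulr1.
rewrite -[z]hsubmxK mul_res1; move: (lsubmx z) (rsubmx z) => y c /rowP/(_ 0) E.
apply/rowP => i; rewrite mxE; move: i; apply: U_indep; exists (c 0 0).
apply/I_gen; exists y.
have -> : \sum_i v 0 i *: U i = (y *m g) 0 0 + f * c 0 0.
  move: E; rewrite summxE [LHS]mxE [X in _ + X = _]mxE => ->.
  by apply: eq_bigr => i _; rewrite !mxE mul_mpolyC.
by rewrite [c 0 0 * f]mulrC addrK.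
Qed.

(** * Periodicity over R *)

Definition factorizable i := exists (A : 'M[P]_(r i.+1, r i)) B,
  map_mx pi A = gc_diff F i /\ matrix_factorization f d (t i.+1) (t i) A B.

(** If y A = f Y, then y A = Y B A and so y = Y B: the kernel of A over R is the row space of B. The
    swapped pair, with shifts raised by d, is a matrix factorization by minimality of F and is
    transferred to the next differential. *)
Lemma factorizable_step i : factorizable i ->
  same_shifts (t i.+2) (fun v => t i v + d%:Z) /\ factorizable i.+1.
Proof.
move=> [A [B [EA [hA hB AB BA _]]]]; have [_ _ _ ex min] := F_res.
have [A' [hA' EA']] := resolution_lift i.+1 F_res.
have AI n0 (X : 'M_(n0, r i.+1)) : X *m A = 0 -> X = 0.
  move=> X0; apply: (fZI f_neq0); rewrite scaler0 -mul_mx_scalar -AB mulmxA X0.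
  by rewrite mul0mx.
have mfBA : matrix_factorization f d (fun v => t i v + d%:Z) (t i.+1) B A.
  split=> //; last first.
    apply/matrixP => u v; rewrite !mxE; apply: (coeff0_irr f0 pi_surj pi_ker).
    by have := min i u v; rewrite -EA mxE.
  move=> u v; have := hA u v.
  by have -> : t i.+1 u + d - (t i v + d) = t i.+1 u - t i v by ring.
have [|x|sh [B' mf]] := matrix_factorization_transfer f_neq0 f_hom f0 pi_surj pi_ker mfBA hA'.
- move=> y; rewrite EA' -ex -EA; split=> [E|[x <-]].
    have [y' Ey] := pi_lift_mx pi_surj y.
    have /(pi_ker_mx pi_ker) [Y EY] : map_mx pi (y' *m A) = 0 by rewrite map_mxM Ey.
    exists (map_mx pi Y); rewrite -map_mxM -Ey; congr map_mx.
    apply/eqP; rewrite -subr_eq0; apply/eqP/AI.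
    by rewrite mulmxBl EY -mulmxA BA mul_mx_scalar subrr.
  rewrite -mulmxA -map_mxM BA map_scalar_mx.
  have -> : pi f = 0 by apply/pi_ker; exists 1; rewrite mul1r.
  by rewrite raddf0 mulmx0.
- by rewrite EA'; apply: kernel_irr.
by split=> //; exists A', B'.
Qed.

Lemma third_shifts (b : int) : r 2 = s ->
  same_shifts (t 2) (fun i => b + a_invariant d - sigma i) ->
  (forall i j, sigma i + sigma j <> b + a_invariant d *+ 2) ->
  same_shifts (t 3) (fun i => sigma i + 3) /\ factorizable 2.
Proof.
move=> r2s [w2 [_ Hw2]] ne; have [Psi [hPsi DPsi PsiD]] := cofactor.
have sh := D_shifts r2s; have [w3 [_ Hw3]] := same_shifts_sym sh.
have mf : matrix_factorization f d a (t 2) D Psi.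
  split=> //; apply/matrixP => u v; rewrite !mxE; apply/eqP/negPn/negP.
  (* A constant term would need degree 0, while the degree is (b + a - sigma_i) + d - (sigma_j + 3)
     = b + 2a - sigma_i - sigma_j. *)
  move=> /(ishom_coeff0 (hPsi u v)); rewrite Hw2 Hw3 /a_invariant => E.
  apply: (ne (w2 u) (w3 v)); rewrite /a_invariant; apply/eqP; rewrite -subr_eq0.
  by apply/eqP; rewrite -[RHS]oppr0 -E; ring.
have [rho [hrho Erho]] := resolution_lift 2 F_res.
have [_ _ _ ex _] := F_res.
have syz x : lifted_syzygy x <-> map_mx pi x *m gc_diff F 1 = 0.
  by rewrite -EPhi -map_mxM (pi_ker_mx pi_ker).
have [|x|sh3 [B mfB]] := matrix_factorization_transfer f_neq0 f_hom f0 pi_surj pi_ker mf hrho.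
- move=> y; rewrite Erho -ex; split=> [E|[x <-]].
    have [y' Ey] := pi_lift_mx pi_surj y.
    have /D_im [x Ex] : lifted_syzygy y' by rewrite syz Ey.
    by exists (map_mx pi x); rewrite -map_mxM Ex.
  have [x' <-] := pi_lift_mx pi_surj x.
  by rewrite -map_mxM -syz D_im; exists x'.
- by rewrite Erho; apply: kernel_irr.
split; last by exists rho, B.
exact: same_shifts_trans sh3 (same_shifts_sym sh).
Qed.

End Data.

Lemma ideal_gen_nil (A : comPzRingType) (x : A) : ideal_gen (fun y => y \in [::]) x -> x = 0.
Proof.
apply: (ideal_gen_sub (Y := fun y => y = 0)) => //; split=> [//|y z -> ->|c y ->].
  by rewrite addr0.
by rewrite mulr0.
Qed.

(* When d = 0 the ring R is zero and J needs no generators. *)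
Lemma pos_degree (k : fieldType) (f : {mpoly k[3]}) d (R : comPzRingType)
    (pi : {rmorphism {mpoly k[3]} -> R}) I :
  f != 0 -> ishom d f -> (forall y, exists p, pi p = y) ->
  (forall p, pi p = 0 <-> exists c, p = c * f) -> has_grade I 3 ->
  (exists m, min_number_of_generators I m /\
     min_number_of_generators (extended_ideal pi I) m) ->
  f@_0 = 0.
Proof.
move=> f_neq0 f_hom surj ker [_ [s [[_ reg] sI sz]] _] [m [[[h sz_h gen_h] _] [_ minJ]]].
apply/eqP/negPn/negP => fn0; have fC := ishom_const f_hom (ishom_coeff0 f_hom fn0).
have pi0 p : pi p = 0.
  apply/ker; exists (p * (f@_0)^-1%:MP).
  by rewrite {2}fC -mulrA -mpolyCM mulVf // mpolyC1 mulr1.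
(* In the zero ring the empty list generates J, so I would be 0 and contain no regular element. *)
have m0 : m = 0%N.
  apply/eqP; rewrite -leqn0; apply: (minJ [::]) => x; have [p <-] := surj x; rewrite pi0.
  by split=> _; apply: ideal_gen0.
have s0 : s`_0 = 0.
  have /gen_h : I s`_0 by apply/sI/mem_nth; rewrite sz.
  by rewrite (size0nil (etrans sz_h m0)) => /ideal_gen_nil.
have := reg 0%N _ 1; rewrite sz take0 s0 mul0r => /(_ isT (ideal_gen0 _)) /ideal_gen_nil.
by move/eqP; rewrite oner_eq0.
Qed.

Theorem theorem1p1
  (k : fieldType)
  (* f, of degree d, and R = P/(f) *)
  (f : {mpoly k[3]}) (d : nat) (f_neq0 : f != 0) (f_homog : f \is d.-homog)
  (R : comPzRingType) (pi : {rmorphism {mpoly k[3]} -> R})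
  (R_quot : is_quotient pi (ideal_gen (fun p => p = f)))
  (* I, with S = P/I *)
  (I : {mpoly k[3]} -> Prop) (I_homog : homogeneous_ideal I)
  (I_grade : has_grade I 3)
  (S : comPzRingType) (q : {rmorphism {mpoly k[3]} -> S})
  (S_quot : is_quotient q I) (S_gor : gorenstein S)
  (G : gcomplex {mpoly k[3]}) (G_res : minimal_resolution idfun G I)
  (b : int) (b_twist : back_twist G b)
  (* the resolution and the socle degrees of R/J, J = IR *)
  (F : gcomplex R) (F_res : minimal_resolution pi F (extended_ideal pi I))
  (s : nat) (sigma : 'I_s -> int)
  (sigma_socle : socle_degrees pi (extended_ideal pi I) sigma)
  (hyp_a : exists m : nat, min_number_of_generators I m /\
                           min_number_of_generators (extended_ideal pi I) m)
  (hyp_b : gc_rank F 2 = s)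
  (hyp_c : forall i j : 'I_s, sigma i + sigma j <> b + a_invariant d *+ 2) :
  [/\ gm_iso (gc_mod pi F 2)
             (gm_free pi (fun i : 'I_s => b + a_invariant d - sigma i)),
      gm_iso (gc_mod pi F 3) (gm_free pi (fun i : 'I_s => sigma i + 3)) &
      forall i : nat, (2 <= i)%N ->
        gm_iso (gc_mod pi F i.+2) (gm_twist (gc_mod pi F i) (- d%:Z))].
Proof.
have [surj quot] := R_quot.
have ker p : pi p = 0 <-> exists c, p = c * f.
  rewrite quot; split=> [|[c ->]]; last exact/ideal_genM/ideal_gen_mem.
  move=> [n [c [g [Hg ->]]]]; exists (\sum_i c i); rewrite mulr_suml.
  by apply: eq_bigr => i _; rewrite Hg.
move/dhomog_ishom in f_homog.
have f0 := pos_degree f_neq0 f_homog surj ker I_grade hyp_a.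
have [proper [rs [rs_reg rsI rs_sz]] _] := I_grade.
have [e0 cof] := regular_sequence_cofinite I_homog rs_reg rsI rs_sz.
have [lam [lam0 lam_deg lam_nondeg]] := socle_functional I_homog proper cof G_res b_twist.
have [g [g_hom gI g_im g_ker]] := first_generators f_homog surj ker I_homog F_res.
have I_gen := first_generators_lift f_neq0 f0 surj ker I_homog F_res g_hom gI g_im g_ker hyp_a.
have [Phi [h [hPhi EPhi Phi_g hh]]] := second_syzygies f_neq0 f_homog ker F_res g_hom g_ker.
have [U [U_hom U_soc U_indep]] := socle_lifts surj ker I_homog sigma_socle.
have le_s : (gc_rank F 2 <= s)%N by rewrite hyp_b.
have sh2 := second_shifts f_neq0 surj ker I_homog F_res g_ker I_gen EPhi Phi_g hh
  U_hom U_soc U_indep cof lam0 lam_deg lam_nondeg le_s.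
have [m0 [D0 [a0 [hD0 imD0]]]] := lifted_syzygy_gens f_homog surj ker F_res EPhi.
have [m [D [a [hD imD minD]]]] := minimal_homogeneous_generators hD0.
have D_im y : lifted_syzygy f Phi y <-> exists x, x *m D = y by rewrite imD0 imD.
have [C [hC DPhi]] := D_Phi f_neq0 f_homog hPhi hD D_im.
have [sh3 fac2] := third_shifts f_neq0 f_homog f0 surj ker F_res g_hom g_ker I_gen
  hPhi EPhi Phi_g hh U_hom U_soc U_indep hD D_im minD hC DPhi hyp_b sh2 hyp_c.
(* [gc_diff F 2] is d_3, so the first instance of periodicity compares F_4 with F_2. *)
have fac i : (2 <= i)%N -> factorizable f d pi F i.
  move=> /subnK <-; elim: (i - 2)%N => [//|j IH].
  exact: (factorizable_step f_neq0 f_homog f0 surj ker F_res IH).2.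
split=> [||i lei]; [exact: same_shifts_iso | exact: same_shifts_iso |].
apply: same_shifts_twist_iso.
have [[w [bw Hw]] _] := factorizable_step f_neq0 f_homog f0 surj ker F_res (fac i lei).
by exists w; split=> // u; rewrite opprK.
Qed.
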